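(* Let $d\in\mathbb{N}^+$ and let $k:\mathbb{R}^d\times\mathbb{R}^d\to\mathbb{R}$ be a continuous, bounded, shift-invariant kernel whose spectral measure $\Lambda$ (given by Bochner's theorem) is a Borel probability measure on $\mathbb{R}^d$, i.e. $k(\mathbf{x},\mathbf{y})=\int_{\mathbb{R}^d}\cos\big(\boldsymbol{\omega}^T(\mathbf{x}-\mathbf{y})\big)\,\mathrm{d}\Lambda(\boldsymbol{\omega})$ for all $\mathbf{x},\mathbf{y}\in\mathbb{R}^d$. Fix multi-indices $\mathbf{p},\mathbf{q}\in\mathbb{N}^d$ and let $$\sigma_{\mathbf{p},\mathbf{q}}=\sqrt{\int_{\mathbb{R}^d}\big|\boldsymbol{\omega}^{\mathbf{p}+\mathbf{q}}\big|^2\,\mathrm{d}\Lambda(\boldsymbol{\omega})}\in(0,\infty),\qquad C_{\mathbf{p},\mathbf{q}}=\frac{\sqrt{\int_{\mathbb{R}^d}\big|\boldsymbol{\omega}^{\mathbf{p}+\mathbf{q}}\big|^2\|\boldsymbol{\omega}\|_2^2\,\mathrm{d}\Lambda(\boldsymbol{\omega})}}{\sigma_{\mathbf{p},\mathbf{q}}},$$ and assume $C_{\mathbf{p},\mathbf{q}}<\infty$ and that for some constant $K\ge 1$ the Bernstein condition $$\int_{\mathbb{R}^d}\frac{|\boldsymbol{\omega}^{\mathbf{p}+\mathbf{q}}|^n}{(\sigma_{\mathbf{p},\mathbf{q}})^n}\,\mathrm{d}\Lambda(\boldsymbol{\omega})\le\frac{n!}{2}K^{n-2},\qquad n=2,3,\ldots$$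 holds. Let $m\in\mathbb{N}^+$, let $\boldsymbol{\omega}_1,\ldots,\boldsymbol{\omega}_m$ be i.i.d. with law $\Lambda$ (joint law $\Lambda^m$), and define $$\widehat{\partial^{\mathbf{p},\mathbf{q}}k}(\mathbf{x},\mathbf{y})=\frac{1}{m}\sum_{j=1}^m\big\langle\partial^{\mathbf{p}}\phi_{\boldsymbol{\omega}_j}(\mathbf{x}),\partial^{\mathbf{q}}\phi_{\boldsymbol{\omega}_j}(\mathbf{y})\big\rangle_{\mathbb{R}^2},\qquad \phi_{\boldsymbol{\omega}}(\mathbf{x})=\big(\cos(\boldsymbol{\omega}^T\mathbf{x}),\sin(\boldsymbol{\omega}^T\mathbf{x})\big).$$ Let $L_m=\frac{\sqrt{6}K}{2\sqrt{m}}$, $C_1=14\sqrt{6\ln 2}+1$, $C_2=36K[\ln 2+1]$, and $C_3=7\sqrt{6}\left(1+\frac{\sqrt{\pi}}{(\ln 2)^{3/2}}\right)$. Then for every $t>0$ and every compact set $\mathscr{S}\subset\mathbb{R}^d$, $$\Lambda^m\Bigg(\Big\{\boldsymbol{\omega}_{1:m}:\ \sup_{\mathbf{x},\mathbf{y}\in\mathscr{S}}\big|\partial^{\mathbf{p},\mathbf{q}}k(\mathbf{x},\mathbf{y})-\widehat{\partial^{\mathbf{p},\mathbf{q}}k}(\mathbf{x},\mathbf{y})\big|\ \ge\ \sigma_{\mathbf{p},\mathbf{q}}\Big(\frac{C_3\sqrt{d\ln(16|\mathscr{S}|C_{\mathbf{p},\mathbf{q}}+4)}}{\sqrt{m}}+\frac{C_1}{\sqrt{m}}+\frac{C_2}{m}+\frac{24\sqrt{6}}{\sqrt{m}}\Big[\sqrt{t}+\frac{L_m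 t}{2}\Big]\Big)\Big\}\Bigg)\le 2e^{-t}.$$
   Context: For a multi-index $\mathbf{p}\in\mathbb{N}^d$ and $\mathbf{v}\in\mathbb{R}^d$, $\mathbf{v}^{\mathbf{p}}=\prod_{j=1}^d v_j^{p_j}$ and $|\mathbf{p}|=\sum_j p_j$. $\partial^{\mathbf{p}}h(\mathbf{x})=\frac{\partial^{|\mathbf{p}|}h(\mathbf{x})}{\partial_{x_1}^{p_1}\cdots\partial_{x_d}^{p_d}}$ (applied componentwise to vector-valued $h$), and $\partial^{\mathbf{p},\mathbf{q}}g(\mathbf{x},\mathbf{y})=\frac{\partial^{|\mathbf{p}|+|\mathbf{q}|}g(\mathbf{x},\mathbf{y})}{\partial_{x_1}^{p_1}\cdots\partial_{x_d}^{p_d}\partial_{y_1}^{q_1}\cdots\partial_{y_d}^{q_d}}$. $|\mathscr{S}|=\sup_{\mathbf{x},\mathbf{y}\in\mathscr{S}}\|\mathbf{x}-\mathbf{y}\|_2$ is the diameter of $\mathscr{S}$; $\ln$ is the natural logarithm.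
   Formalization: The formal statement additionally assumes that the iterated partial derivatives defining ∂^{p,q}k exist everywhere on R^d×R^d; for d≥2 the stated moment conditions do not guarantee this, and ∂^{p,q}k can then be undefined. *)

(* Defs.v *)
From HB Require Import structures.
From mathcomp Require Import all_boot all_order all_algebra.
From mathcomp Require Import all_classical all_reals all_analysis.
Set Implicit Arguments. Unset Strict Implicit. Unset Printing Implicit Defensive.
Import Order.TTheory GRing.Theory Num.Theory.
Import numFieldTopology.Exports numFieldNormedType.Exports.
Local Open Scope classical_set_scope.
Local Open Scope ring_scope.

(* Conventions: points x, y of R^d (where kernels are evaluated and
   differentiated) are row vectors 'rV[R]_d (normed space, library topology,
   compactness and derivatives); frequencies omega (the random variables) are
   d.-tuples of reals, carrying the library's product (= Borel) sigma-algebra. *)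

Section Defs.
Variables (R : realType) (d : nat).

Definition dotv (w : d.-tuple R) (x : 'rV[R]_d) : R :=
  \sum_(i < d) tnth w i * x ord0 i.

Definition mono (w : d.-tuple R) (r : d.-tuple nat) : R :=
  \prod_(i < d) tnth w i ^+ tnth r i.

Definition addmi (p q : d.-tuple nat) : d.-tuple nat :=
  [tuple tnth p i + tnth q i | i < d].

Definition tnorm2 (w : d.-tuple R) : R := Num.sqrt (\sum_(i < d) tnth w i ^+ 2).
Definition vnorm2 (x : 'rV[R]_d) : R := Num.sqrt (\sum_(i < d) x ord0 i ^+ 2).

Definition diam (S : set 'rV[R]_d) : R :=
  sup [set r | exists x y, S x /\ S y /\ r = vnorm2 (x - y)].

Definition partial (i : 'I_d) (f : 'rV[R]_d -> R) : 'rV[R]_d -> R :=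
  fun x => 'D_(delta_mx 0 i) f x.

Definition dseq (p : d.-tuple nat) : seq 'I_d :=
  flatten [seq nseq (tnth p i) i | i <- enum 'I_d].

Definition Dseq (s : seq 'I_d) (f : 'rV[R]_d -> R) : 'rV[R]_d -> R :=
  foldr partial f s.

Fixpoint Dok (s : seq 'I_d) (f : 'rV[R]_d -> R) : Prop :=
  match s with
  | [::] => True
  | i :: s' => Dok s' f /\ forall x, derivable (Dseq s' f) x (delta_mx 0 i)
  end.

Definition Dmulti (p : d.-tuple nat) (h : 'rV[R]_d -> R) : 'rV[R]_d -> R :=
  Dseq (dseq p) h.

Definition Dpq (p q : d.-tuple nat) (g : 'rV[R]_d -> 'rV[R]_d -> R)
  (x y : 'rV[R]_d) : R :=
  Dmulti p (fun x' => Dmulti q (g x') y) x.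

Definition Dpq_exists (p q : d.-tuple nat) (g : 'rV[R]_d -> 'rV[R]_d -> R) : Prop :=
  (forall x, Dok (dseq q) (g x)) /\
  (forall y, Dok (dseq p) (fun x' => Dmulti q (g x') y)).

Definition khat (m : nat) (w : 'I_m -> d.-tuple R) (p q : d.-tuple nat)
  (x y : 'rV[R]_d) : R :=
  m%:R^-1 * \sum_(j < m)
    (Dmulti p (fun z => cos (dotv (w j) z)) x * Dmulti q (fun z => cos (dotv (w j) z)) y
   + Dmulti p (fun z => sin (dotv (w j) z)) x * Dmulti q (fun z => sin (dotv (w j) z)) y).

Definition iid_law {d0} {Omega : measurableType d0} (P : probability Omega R)
  (m : nat) (X : 'I_m -> Omega -> d.-tuple R) (L : probability (d.-tuple R) R) : Prop :=
  [/\ forall j, measurable_fun setT (X j),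
      forall j (B : set (d.-tuple R)), measurable B -> P (X j @^-1` B) = L B &
      forall B : 'I_m -> set (d.-tuple R), (forall j, measurable (B j)) ->
        P [set a | forall j, B j (X j a)] =
        (\prod_(j < m) fine (P (X j @^-1` B j)))%:E].

End Defs.

(* Main.v *)
Require Import Defs.
From HB Require Import structures.
From mathcomp Require Import all_boot all_order all_algebra.
From mathcomp Require Import all_classical all_reals all_analysis.
From mathcomp Require Import measurable_realfun ring lra.
Set Implicit Arguments. Unset Strict Implicit. Unset Printing Implicit Defensive.
Import Order.TTheory GRing.Theory Num.Theory.
Import numFieldTopology.Exports numFieldNormedType.Exports.
Local Open Scope classical_set_scope.
Local Open Scope ring_scope.

(* With [c0 = (|p| - |q|) pi / 2] and [g_z(w) = w^(p+q) cos (w . z + c0)], the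
   derivative of the kernel at [(x, y)] is the [Lam]-mean of [g_(x-y)] and its
   estimate the empirical mean, so the supremum is that of an empirical process
   indexed by a ball of radius [|S|]. It is bounded by chaining along nets of
   scales [2^-s]. Since [w^(p+q)] is unbounded, the increment at level [s] is kept
   only where all the envelopes up to level [s] are below thresholds that balance
   the two terms of Bernstein's inequality; what is cut off is dominated by one
   fixed function of [w], whose mean is small and whose deviation is controlled by
   the moment condition through a single application of Bernstein's inequality. *)

(** The obstacle is that the Lipschitz envelope has only a second moment, while the bound carries
    the entropy [D = d ln(...)] under a square root and nowhere else. Bernstein's inequality with
    the constant [K] at every level would leave linear terms of size [K D / m], which neither shrink
    with the scale nor fit under the bound; this happens already at level 0, so truncation starts
    there. Cutting an increment of L2 size [v] at height [al = v / q], with [q = sqrt (u / m)],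
    makes the linear term [2 al q^2] equal to the Gaussian term [2 v q]; and the part cut off has
    mean at most [v^2 / al = v q], the same size again. All levels together thus cost a multiple of
    the sum of the [v q], and [K] survives only next to [t / m], through the single dominating
    function, which needs no union bound. The constants leave room: this route gives 36, 16 and
    [4 K] as factors of [sqrt (D / m)], [sqrt (t / m)] and [t / m], where the statement has at least
    36, [24 sqrt 6] and [36 K]. *)

(** * Nets of Euclidean balls and the Cauchy-Schwarz inequality *)

Section Cover.
Variable R : realType.

(** The full series sums to [1 / (1 - r)], which is at most [1 + M] because
    [expR M^-1 >= 1 + M^-1]. *)
Lemma geometric_sum_le (M : R) (N : nat) : 0 < M ->
  \sum_(j < N) expR (- (j%:R / M)) <= 1 + M.
Proof.
move=> M0.
set r := expR (- M^-1).
have rE (j : nat) : expR (- (j%:R / M)) = r ^+ j.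
  by rewrite /r -expRM_natl mulrN.
rewrite (eq_bigr (fun j : 'I_N => r ^+ j)); last by move=> j _; rewrite rE.
have r0 : 0 < r by exact: expR_gt0.
have h : r * (1 + M) <= M.
  have := expR_ge1Dx M^-1.
  have -> : expR M^-1 = r^-1 by rewrite /r expRN invrK.
  rewrite -(ler_pM2l r0) mulfV ?gt_eqF// -(ler_pM2r M0) mul1r.
  by rewrite -mulrA mulrDl mul1r mulVf ?gt_eqF// [M + 1]addrC.
have r1 : r < 1 by nra.
have := subrX1 r N; set s := \sum_(i < N) _ => sE.
have rN : 0 <= r ^+ N by rewrite exprn_ge0// ltW.
rewrite -(ler_pM2l (_ : 0 < 1 - r)) ?subr_gt0//.
nra.
Qed.

(** An exponential Markov bound for counting: each counted [f] has weight
    [\prod_i expR (1 - f i / M) >= 1], and the total weight of all functions factorises into [d]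
    geometric sums. *)
Lemma card_sum_le (d N : nat) (M : R) : 0 < M ->
  #|[set f : {ffun 'I_d -> 'I_N} | (\sum_i nat_of_ord (f i))%:R <= d%:R * M]%SET|%:R
    <= (expR 1 * (1 + M)) ^+ d.
Proof.
move=> M0; set A := (X in #|pred_of_set X|).
rewrite -sum1_card natr_sum.
apply: (@le_trans _ _
  (\sum_(f : {ffun 'I_d -> 'I_N}) \prod_i expR (1 - (f i)%:R / M))).
  rewrite [leRHS](bigID (mem A)) /= -[leLHS]addr0 lerD//; last first.
    by apply: sumr_ge0 => f _; apply: prodr_ge0 => i _; exact: expR_ge0.
  apply: ler_sum => f; rewrite inE natr_sum => fA.
  rewrite -expR_sum -[leLHS]expR0 ler_expR sumrB -mulr_suml sumr_const card_ord.
  by rewrite subr_ge0 ler_pdivrMr.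
rewrite -(bigA_distr_bigA (fun (_ : 'I_d) (j : 'I_N) => expR (1 - j%:R / M))) /=.
rewrite prodr_const card_ord; apply: lerXn2r; rewrite ?nnegrE.
- by apply: sumr_ge0 => i _; exact: expR_ge0.
- by rewrite mulr_ge0 ?expR_ge0// addr_ge0// ltW.
under eq_bigr do rewrite expRD.
by rewrite -mulr_sumr ler_pM2l ?expR_gt0// geometric_sum_le.
Qed.

Lemma vnorm2_ge0 d (x : 'rV[R]_d) : 0 <= vnorm2 x.
Proof. exact: sqrtr_ge0. Qed.

Lemma sqr_vnorm2 d (x : 'rV[R]_d) : vnorm2 x ^+ 2 = \sum_i x ord0 i ^+ 2.
Proof. by rewrite sqr_sqrtr// sumr_ge0// => i _; exact: sqr_ge0. Qed.

Lemma vnorm2_le d (x : 'rV[R]_d) (r : R) : 0 <= r ->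
  (vnorm2 x <= r) = (\sum_i x ord0 i ^+ 2 <= r ^+ 2).
Proof. by move=> r0; rewrite -sqr_vnorm2 ler_sqr// nnegrE vnorm2_ge0. Qed.

(* The net is a grid of step [eps / sqrt d]; a point of the ball has integer
   coordinates of total size at most [d M], so the grid points are counted by
   [card_sum_le] without the [sqrt d] that a cube would cost. *)
Lemma ball_net (d : nat) (r eps M : R) : (0 < d)%N -> 0 <= r -> 0 < eps -> 0 < M ->
  r <= M * eps ->
  exists s : seq 'rV[R]_d, (size s)%:R <= (expR 1 * (2 + 2 * M)) ^+ d /\
    forall z, vnorm2 z <= r -> exists2 x, x \in s & vnorm2 (z - x) <= eps.
Proof.
move=> d0 r0 e0 M0 rM.
pose h := eps / Num.sqrt d%:R.
have sd0 : 0 < Num.sqrt d%:R :> R by rewrite sqrtr_gt0 ltr0n.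
have h0 : 0 < h by rewrite divr_gt0.
have dh : d%:R * h ^+ 2 = eps ^+ 2.
  by rewrite /h expr_div_n sqr_sqrtr// mulrC divfK// pnatr_eq0 -lt0n.
pose N := (Num.truncn (d%:R * M)).+1.
pose A := [set f : {ffun 'I_d -> 'I_N} | (\sum_i nat_of_ord (f i))%:R <= d%:R * M]%SET.
(* Absolute values and signs are chosen separately; the signs contribute the factor [2 ^ d]. *)
pose pt (u : {ffun 'I_d -> 'I_N} * {ffun 'I_d -> bool}) : 'rV[R]_d :=
  \row_i ((-1) ^+ (u.2 i) * (u.1 i)%:R * h).
exists [seq pt u | u in finset.setX A [set: {ffun 'I_d -> bool}]%SET]; split.
  rewrite size_image finset.cardsX cardsT card_ffun card_bool card_ord natrM natrX.
  have -> : expR 1 * (2 + 2 * M) = (expR 1 * (1 + M)) * 2 :> R by ring.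
  by rewrite exprMn ler_wpM2r ?exprn_ge0// card_sum_le.
move=> z zr.
have z2 : \sum_i z ord0 i ^+ 2 <= M ^+ 2 * (d%:R * h ^+ 2).
  rewrite dh -exprMn; apply: le_trans (_ : r ^+ 2 <= _); first by rewrite -vnorm2_le.
  by rewrite ler_sqr// nnegrE// mulr_ge0// ltW.
pose n i := Num.truncn (`|z ord0 i| / h).
have nle i : (n i)%:R * h <= `|z ord0 i| < (n i).+1%:R * h.
  have := @truncn_itv _ (`|z ord0 i| / h) (divr_ge0 (normr_ge0 _) (ltW h0)).
  by rewrite ler_pdivlMr// ltr_pdivrMr.
(* From [2 y <= y^2 / M + M] at [y = |z_i| / h]: after halving, each of the two terms sums to at
   most [d M / 2]. *)
have sn : (\sum_i n i)%:R <= d%:R * M.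
  rewrite natr_sum.
  apply: (@le_trans _ _ (\sum_i (z ord0 i ^+ 2 / (M * h ^+ 2) + M) / 2)).
    apply: ler_sum => i _; have /andP[+ _] := nle i.
    rewrite -ler_pdivlMr// => /le_trans; apply.
    rewrite -(real_normK (num_real (z ord0 i))); set y := `|_|.
    have -> : y ^+ 2 / (M * h ^+ 2) = (y / h) ^+ 2 / M by field; rewrite !gt_eqF.
    rewrite ler_pdivlMr// -subr_ge0.
    have -> : (y / h) ^+ 2 / M + M - y / h * 2 = (y / h - M) ^+ 2 / M.
      by field; rewrite !gt_eqF.
    by rewrite divr_ge0 ?sqr_ge0// ltW.
  rewrite -mulr_suml big_split /= -mulr_suml sumr_const card_ord -[M *+ d]mulr_natl.
  rewrite ler_pdivrMr//.
  have : (\sum_i z ord0 i ^+ 2) / (M * h ^+ 2) <= d%:R * M.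
    have Mh0 : 0 < M * h ^+ 2 by rewrite mulr_gt0// exprn_gt0.
    rewrite ler_pdivrMr//; apply: (le_trans z2).
    by rewrite le_eqVlt; apply/orP; left; apply/eqP; ring.
  lra.
have nN i : (n i < N)%N.
  rewrite ltnS -ltnS; apply: leq_ltn_trans (_ : n i <= \sum_i n i)%N _.
    by rewrite (bigD1 i)//= leq_addr.
  rewrite -(ltr_nat R); apply: le_lt_trans sn _.
  by have /andP[] := @truncn_itv _ (d%:R * M) (mulr_ge0 (ler0n _ _) (ltW M0)).
pose u := ([ffun i => Ordinal (nN i)], [ffun i => z ord0 i < 0]).
exists (pt u).
  apply: fintype.image_f; rewrite finset.in_setX !inE andbT /=.
  by rewrite (eq_bigr n)// => i _; rewrite ffunE.
(* Rounding towards 0 moves each coordinate by at most [h], and [d h^2 = eps^2]. *)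
rewrite vnorm2_le; last exact: ltW.
rewrite -dh mulr_natl -[in leRHS](card_ord d) -sumr_const.
apply: ler_sum => i _; rewrite !mxE !ffunE /=.
have /andP[] := nle i; rewrite -natr1 mulrDl mul1r -mulrA.
case: (ltrP (z ord0 i) 0) => zi; [rewrite ltr0_norm//|rewrite ger0_norm//];
  move: ((n i)%:R * h) => y.
  by rewrite expr1 mulN1r; nra.
by rewrite expr0 mul1r; nra.
Qed.

(** Cauchy-Schwarz, from [2 a b <= a^2 c + b^2 / c] at the optimal [c = vnorm2 x / tnorm2 w];
    vanishing norms are treated apart because [c] must be positive and finite. *)
Lemma dotv_le d (w : d.-tuple R) (x : 'rV[R]_d) : `|dotv w x| <= tnorm2 w * vnorm2 x.
Proof.
have t2 : tnorm2 w ^+ 2 = \sum_i tnth w i ^+ 2.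
  by rewrite sqr_sqrtr// sumr_ge0// => i _; exact: sqr_ge0.
have t0 : 0 <= tnorm2 w by exact: sqrtr_ge0.
have key (c : R) : 0 < c -> `|dotv w x| <= (tnorm2 w ^+ 2 * c + vnorm2 x ^+ 2 / c) / 2.
  move=> c0; rewrite t2 sqr_vnorm2 !mulr_suml -big_split /= mulr_suml.
  apply: le_trans (ler_norm_sum _ _ _) _; apply: ler_sum => i _.
  rewrite normrM -[tnth w i ^+ 2]real_normK ?num_real//.
  rewrite -[x ord0 i ^+ 2]real_normK ?num_real//.
  set a := `|tnth w i|; set b := `|x ord0 i|.
  rewrite ler_pdivlMr// -subr_ge0.
  have -> : a ^+ 2 * c + b ^+ 2 / c - a * b * 2 = (a * c - b) ^+ 2 / c.
    by field; rewrite gt_eqF.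
  by rewrite divr_ge0 ?sqr_ge0// ltW.
have [x0|x0] := eqVneq (vnorm2 x) 0.
  rewrite /dotv big1 ?normr0 ?x0 ?mulr0// => i _.
  move: (sqr_vnorm2 x); rewrite x0 expr0n /= => /esym/eqP.
  rewrite psumr_eq0 => [/allP/(_ i)|j _]; last exact: sqr_ge0.
  by rewrite mem_index_enum sqrf_eq0 => /(_ isT)/eqP ->; rewrite mulr0.
have {}x0 : 0 < vnorm2 x by rewrite lt_def x0 vnorm2_ge0.
have [w0|w0] := eqVneq (tnorm2 w) 0.
  rewrite /dotv big1 ?normr0 ?w0 ?mul0r// => i _.
  move: t2; rewrite w0 expr0n /= => /esym/eqP.
  rewrite psumr_eq0 => [/allP/(_ i)|j _]; last exact: sqr_ge0.
  by rewrite mem_index_enum sqrf_eq0 => /(_ isT)/eqP ->; rewrite mul0r.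
have {}w0 : 0 < tnorm2 w by rewrite lt_def w0 t0.
apply: le_trans (key (vnorm2 x / tnorm2 w) (divr_gt0 x0 w0)) _.
rewrite le_eqVlt; apply/orP; left; apply/eqP; field.
by rewrite !gt_eqF.
Qed.

(** A squared substitute for the triangle inequality; the nets are fine enough to afford the factor
    2. *)
Lemma sqr_vnorm2B d (x y z : 'rV[R]_d) :
  vnorm2 (x - y) ^+ 2 <= 2 * (vnorm2 (z - x) ^+ 2 + vnorm2 (z - y) ^+ 2).
Proof.
rewrite !sqr_vnorm2 -big_split /= mulr_sumr; apply: ler_sum => i _.
rewrite !mxE; move: (x ord0 i) (y ord0 i) (z ord0 i) => a b c.
have := sqr_ge0 (c - a + (c - b)); nra.
Qed.

End Cover.

Lemma sum_half_expn {R : realType} n :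
  \sum_(0 <= i < n) 2^-1 ^+ i.+1 = 1 - 2^-1 ^+ n :> R.
Proof.
elim: n => [|n IH]; first by rewrite big_geq// expr0 subrr.
by rewrite big_nat_recr//= IH !exprS; field.
Qed.

(** * Integrals over a probability space and exponential moments under Bernstein's condition *)

Section Integration.
Context {dT : measure_display} {T : measurableType dT} {R : realType}.
Variable L : probability T R.

Lemma integrable_le (f g : T -> R) : measurable_fun setT f ->
  (forall x, `|f x| <= g x) -> L.-integrable setT (EFin \o g) ->
  L.-integrable setT (EFin \o f).
Proof.
move=> mf fg; apply: le_integrable => //; first exact/measurable_EFinP.
by move=> x _ /=; rewrite lee_fin (le_trans (fg x))// ler_norm.
Qed.

Lemma integrable_ge0 (f : T -> R) : measurable_fun setT f -> (forall x, 0 <= f x) ->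
  (\int[L]_x (f x)%:E < +oo)%E -> L.-integrable setT (EFin \o f).
Proof.
move=> mf f0 fi; apply/integrableP; split; first exact/measurable_EFinP.
by under eq_integral do rewrite /= ger0_norm//.
Qed.

Lemma integrable_cst1 (c : R) : L.-integrable setT (EFin \o (fun _ : T => c)).
Proof. exact: finite_measure_integrable_cst. Qed.

Lemma Rintegral_cst1 (c : R) : \int[L]_(x in setT) c = c.
Proof.
rewrite Rintegral_cst// -[RHS]mulr1 -[X in _ = _ * X]/(fine 1%:E).
by congr (_ * fine _); exact: probability_setT.
Qed.

Lemma EFin_Rintegral (f : T -> R) : L.-integrable setT (EFin \o f) ->
  (\int[L]_x (f x)%:E)%E = (\int[L]_x f x)%:E.
Proof. by move=> fi; rewrite /Rintegral fineK//; exact: integrable_fin_num. Qed.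

Lemma integrableDR (f g : T -> R) : L.-integrable setT (EFin \o f) ->
  L.-integrable setT (EFin \o g) -> L.-integrable setT (EFin \o (fun x => f x + g x)).
Proof. by move=> fi gi; exact: (@integrableD _ _ _ L setT measurableT _ _ fi gi). Qed.

Lemma integrableBR (f g : T -> R) : L.-integrable setT (EFin \o f) ->
  L.-integrable setT (EFin \o g) -> L.-integrable setT (EFin \o (fun x => f x - g x)).
Proof. by move=> fi gi; exact: (@integrableB _ _ _ L setT measurableT _ _ fi gi). Qed.

Lemma integrableZR (c : R) (f : T -> R) : L.-integrable setT (EFin \o f) ->
  L.-integrable setT (EFin \o (fun x => c * f x)).
Proof. by move=> fi; exact: (@integrableZl _ _ _ L setT measurableT c _ fi). Qed.

Lemma integrable_sqr (f : T -> R) : measurable_fun setT f ->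
  (\int[L]_x (f x ^+ 2)%:E < +oo)%E -> L.-integrable setT (EFin \o f).
Proof.
move=> mf f2; apply: (@integrable_le _ (fun x => 1 + f x ^+ 2)) => //.
  move=> x; rewrite -[f x ^+ 2]real_normK ?num_real//.
  by have := sqr_ge0 (`|f x| - 1); nra.
apply: integrableDR; first exact: integrable_cst1.
by apply: integrable_ge0 => //; [exact: measurable_funX|move=> x; exact: sqr_ge0].
Qed.

(** The extended-real series with nonnegative terms can later be integrated term by term without any
    summability condition. *)
Lemma expR_taylor_ub (z : R) : 0 <= z ->
  ((expR z)%:E <= (1 + z)%:E + \sum_(0 <= n <oo) (z ^+ n.+2 / (n.+2)`!%:R)%:E)%E.
Proof.
move=> z0; rewrite /expR -EFin_lim; last exact: is_cvg_series_exp_coeff.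
have t0 n : (0 <= (z ^+ n.+2 / (n.+2)`!%:R)%:E :> \bar R)%E.
  by rewrite lee_fin divr_ge0// exprn_ge0.
apply: lime_le.
  apply/cvg_ex; exists (expR z)%:E; apply: cvg_EFin; first exact: nearW.
  exact: is_cvg_series_exp_coeff.
near=> N.
have [N' ->] : exists N', N = N'.+2.
  by exists N.-2; rewrite -[LHS](subnK (_ : 2 <= N)%N) ?subn2 ?addn2//; near: N; exists 2%N.
rewrite /= /series /= big_nat_recl// big_nat_recl//= /exp_coeff /= expr0 fact0 divr1 expr1 divr1.
rewrite addrA EFinD leeD2l// -sumEFin; exact: nneseries_lim_ge.
Unshelve. all: by end_near. Qed.

(** The series of [expR z - 1 - z] has nonnegative coefficients, so its value at [y] is at most its
    value at [|y|]. This keeps the linear term signed while absolute moments control the rest. *)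
Lemma expR_le_abs (y : R) : expR y <= expR `|y| + (y - `|y|).
Proof.
have c1 := is_cvg_series_exp_coeff (R := R).
have -> : expR `|y| + (y - `|y|) = limn (fun n => series (exp_coeff `|y|) n + (y - `|y|)).
  rewrite limD//; last exact: is_cvg_cst.
  by rewrite lim_cst.
apply: ler_lim => //; first by apply: is_cvgD => //; exact: is_cvg_cst.
near=> N.
have [N' ->] : exists N', N = N'.+2.
  by exists N.-2; rewrite -[LHS](subnK (_ : 2 <= N)%N) ?subn2 ?addn2//; near: N; exists 2%N.
rewrite /series /= !big_nat_recl//= /exp_coeff /= !expr0 fact0 !divr1 !expr1.
have : \sum_(0 <= i < N') y ^+ i.+2 / (i.+2)`!%:R
    <= \sum_(0 <= i < N') `|y| ^+ i.+2 / (i.+2)`!%:R.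
  by apply: ler_sum => i _; rewrite ler_wpM2r ?invr_ge0// -normrX ler_norm.
lra.
Unshelve. all: by end_near. Qed.

(** The moment condition cancels the factorials of the exponential series and leaves
    [lam^2 v^2 (lam b)^n / 2]; with [lam b <= 1/2] these sum to at most [lam^2 v^2]. The linear term
    is kept exactly, and [1 + x <= expR x] concludes. *)
Lemma mgf_le (xi : T -> R) (v b lam : R) : measurable_fun setT xi ->
  0 < b -> 0 <= lam -> lam * b <= 2^-1 ->
  (forall n, (2 <= n)%N ->
    (\int[L]_x (`|xi x| ^+ n)%:E <= (n`!%:R / 2 * (v ^+ 2 * b ^+ (n - 2)))%:E)%E) ->
  (\int[L]_x (expR (lam * xi x))%:E
     <= (expR (lam * \int[L]_x xi x + lam ^+ 2 * v ^+ 2))%:E)%E.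
Proof.
move=> mxi b0 lam0 lamb mom.
have mn : measurable_fun setT (fun x => lam * `|xi x|).
  by apply: measurable_funM => //; apply: measurableT_comp => //; exact: normr_measurable.
pose G x := expR (lam * `|xi x|) - 1 - lam * `|xi x|.
have mG : measurable_fun setT G.
  apply: measurable_funB => //; apply: measurable_funB => //.
  exact: measurableT_comp.
have G0 x : 0 <= G x by rewrite /G -addrA -opprD subr_ge0 expR_ge1Dx.
have Gle : (\int[L]_x (G x)%:E <= (lam ^+ 2 * v ^+ 2)%:E)%E.
  apply: (@le_trans _ _ (\int[L]_x
      \sum_(0 <= n <oo) ((lam * `|xi x|) ^+ n.+2 / (n.+2)`!%:R)%:E)%E).
    apply: ge0_le_integral => //.
    - by move=> x _; rewrite lee_fin.
    - exact/measurable_EFinP.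
    - apply: (@ge0_emeasurable_sum _ _ _ _ _ xpredT).
        by move=> n x _ _; rewrite lee_fin divr_ge0// exprn_ge0// mulr_ge0.
      by move=> n _; apply/measurable_EFinP; apply: measurable_funM => //; exact: measurable_funX.
    move=> x _.
    have := @expR_taylor_ub (lam * `|xi x|) (mulr_ge0 lam0 (normr_ge0 _)).
    rewrite -leeBlDl// /G -addrA -opprD EFinB.
    by rewrite (addeC (expR _)%:E).
  rewrite integral_nneseries//; last 2 first.
  - by move=> n; apply/measurable_EFinP; apply: measurable_funM => //; exact: measurable_funX.
  - by move=> n x _; rewrite lee_fin divr_ge0// exprn_ge0// mulr_ge0.
  have tle n : (\int[L]_x ((lam * `|xi x|) ^+ n.+2 / (n.+2)`!%:R)%:E
      <= (lam ^+ 2 * v ^+ 2 * 2^-1 ^+ n.+1)%:E)%E.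
    have -> : (\int[L]_x ((lam * `|xi x|) ^+ n.+2 / (n.+2)`!%:R)%:E
        = (lam ^+ n.+2 / (n.+2)`!%:R)%:E * \int[L]_x (`|xi x| ^+ n.+2)%:E)%E.
      rewrite -ge0_integralZl//.
      - by apply: eq_integral => x _; rewrite -EFinM exprMn mulrAC.
      - apply/measurable_EFinP; apply: measurable_funX; apply: measurableT_comp => //.
      - by rewrite lee_fin divr_ge0// exprn_ge0.
    apply: le_trans (lee_wpmul2l _ (mom n.+2 isT)) _.
      by rewrite lee_fin divr_ge0// exprn_ge0.
    rewrite -EFinM lee_fin subn2 /=.
    have -> : lam ^+ n.+2 / (n.+2)`!%:R * ((n.+2)`!%:R / 2 * (v ^+ 2 * b ^+ n))
        = lam ^+ 2 * v ^+ 2 * ((lam * b) ^+ n / 2).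
      rewrite exprMn -addn2 exprD; field.
      by rewrite pnatr_eq0 -lt0n fact_gt0.
    have lv0 : 0 <= lam ^+ 2 * v ^+ 2 by rewrite mulr_ge0 ?sqr_ge0.
    rewrite (ler_wpM2l lv0)// exprS mulrC (ler_wpM2l (_ : 0 <= 2^-1))// ?invr_ge0//.
    by rewrite lerXn2r// nnegrE ?mulr_ge0// ?invr_ge0// ltW.
  apply: lime_le.
    by apply: is_cvg_nneseries => n _ _; apply: integral_ge0 => x _;
      rewrite lee_fin divr_ge0// exprn_ge0// mulr_ge0.
  apply: nearW => N.
  apply: le_trans (lee_sum _ (fun n _ => tle n)) _.
  rewrite sumEFin lee_fin -mulr_sumr; apply: ler_piMr; first by rewrite mulr_ge0 ?sqr_ge0.
  by rewrite sum_half_expn gerBl exprn_ge0 ?invr_ge0.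
have Gi : L.-integrable setT (EFin \o G).
  by apply: integrable_ge0 => //; exact: le_lt_trans Gle (ltry _).
have xii : L.-integrable setT (EFin \o xi).
  apply: integrable_sqr => //.
  under eq_integral do rewrite -real_normK ?num_real//.
  exact: le_lt_trans (mom 2%N isT) (ltry _).
have li : L.-integrable setT (EFin \o (fun x => lam * xi x)).
  exact: integrableZR.
have li1 : L.-integrable setT (EFin \o (fun x => 1 + lam * xi x)).
  by apply: integrableDR => //; exact: integrable_cst1.
apply: (@le_trans _ _ (\int[L]_x (1 + lam * xi x + G x)%:E)%E).
  apply: ge0_le_integral => //.
  - by apply/measurable_EFinP; apply: measurableT_comp => //; exact: measurable_funM.
  - apply/measurable_EFinP; apply: measurable_funD => //; apply: measurable_funD => //.
    exact: measurable_funM.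
  move=> x _; rewrite lee_fin /G; have := expR_le_abs (lam * xi x).
  rewrite normrM (ger0_norm lam0); lra.
have li2 : L.-integrable setT (EFin \o (fun x => 1 + lam * xi x + G x)).
  exact: integrableDR.
rewrite EFin_Rintegral// lee_fin RintegralD// RintegralD//; last exact: integrable_cst1.
rewrite Rintegral_cst1 RintegralZl//.
apply: le_trans (expR_ge1Dx _); rewrite addrA lerD2l.
by rewrite -lee_fin -EFin_Rintegral.
Qed.

End Integration.

(** * Independence and Bernstein's inequality *)

Section Independence.
Context {R : realType} {d : nat} {d0 : measure_display} {Omega : measurableType d0}.
Variables (P : probability Omega R) (m : nat) (W : 'I_m -> Omega -> d.-tuple R).
Variable L : probability (d.-tuple R) R.
Hypothesis hW : iid_law P W L.

(** Independence is given on rectangles only. Expanding the product of sums over all choices of one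
    [B i] per sample turns the integrand into a combination of indicators of rectangles, and the
    same expansion read backwards gives the power. *)
Lemma iid_step (N : nat) (c : 'I_N -> R) (B : 'I_N -> set (d.-tuple R)) :
  (forall i, 0 <= c i) -> (forall i, measurable (B i)) ->
  (\int[P]_a (\prod_j \sum_i c i * \1_(B i) (W j a))%:E
    = ((\sum_i c i * fine (L (B i))) ^+ m)%:E)%E.
Proof.
have [mW lW iW] := hW; move=> c0 mB.
pose E (f : {ffun 'I_m -> 'I_N}) := [set a | forall j, B (f j) (W j a)].
have mE f : measurable (E f).
  rewrite (_ : E f = \bigcap_(j in setT) (W j @^-1` B (f j))).
    apply: fin_bigcap_measurable => // j _.
    by rewrite -[X in measurable X]setTI; exact: mW.
  by apply/seteqP; split=> a /= h j; [move=> _|]; exact: h.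
have stepE a : \prod_j \sum_i c i * \1_(B i) (W j a)
    = \sum_(f : {ffun 'I_m -> 'I_N}) (\prod_j c (f j)) * \1_(E f) a.
  rewrite (bigA_distr_bigA (fun j i => c i * \1_(B i) (W j a))).
  apply: eq_bigr => f _; rewrite big_split /=; congr (_ * _).
  rewrite indicE; case: (boolP (a \in E f)) => [/set_mem aE|/negP aE].
    by rewrite big1// => j _; rewrite indicE mem_set//; exact: aE.
  have [j nj] : exists j, ~ B (f j) (W j a).
    by apply: contrapT => /forallNP h; apply: aE; apply: mem_set => j; exact: contrapT (h j).
  by rewrite (bigD1 j)//= indicE memNset// mul0r.
under eq_integral do rewrite stepE -sumEFin.
have cf0 (f : {ffun 'I_m -> 'I_N}) : 0 <= \prod_j c (f j) by apply: prodr_ge0.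
rewrite ge0_integral_sum//; last 2 first.
- move=> f; apply/measurable_EFinP; apply: measurable_funM => //; exact: measurable_indic.
- by move=> f a _; rewrite lee_fin mulr_ge0// indicE.
rewrite -[in RHS](card_ord m) -prodr_const bigA_distr_bigA -sumEFin.
apply: eq_bigr => f _.
under eq_integral do rewrite EFinM.
rewrite ge0_integralZl//; last 2 first.
- apply/measurable_EFinP; exact: measurable_indic.
- by rewrite lee_fin.
have PE : P (E f) = (\prod_(j < m) fine (P (W j @^-1` B (f j))))%:E.
  exact: (iW (fun j => B (f j))).
rewrite integral_indic// setIT [X in (_ * X)%E]PE -EFinM [in RHS]big_split /=.
by congr (_ * _)%:E; apply: eq_bigr => j _; rewrite lW.
Qed.

Import HBNNSimple.

Lemma iid_nnsfun (f : {nnsfun d.-tuple R >-> R}) :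
  (\int[P]_a (\prod_j f (W j a))%:E = ((fine (\int[L]_x (f x)%:E)) ^+ m)%:E)%E.
Proof.
pose s : seq R := finmap.enum_fset (fset_set (range f)).
pose N := size s; pose c (i : 'I_N) := nth 0 s i.
pose B i := f @^-1` [set c i].
have fE x : f x = \sum_i c i * \1_(B i) x.
  by rewrite fimfunE fsbig_finite//= (big_nth 0) big_mkord.
have c0 i : 0 <= c i.
  have : c i \in s by exact: mem_nth.
  by rewrite in_fset_set// => /set_mem[x _ <-].
have mB i : measurable (B i) by exact: measurable_sfunP.
under eq_integral do (under eq_bigr do rewrite fE).
rewrite iid_step//; congr (_ ^+ _)%:E.
under eq_integral do rewrite fE -sumEFin.
rewrite ge0_integral_sum//; last 2 first.
- move=> i; apply/measurable_EFinP; apply: measurable_funM => //; exact: measurable_indic.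
- by move=> i a _; rewrite lee_fin mulr_ge0// indicE.
have ci i : (\int[L]_x (c i * \1_(B i) x)%:E = (c i * fine (L (B i)))%:E)%E.
  under eq_integral do rewrite EFinM.
  rewrite ge0_integralZl//; last 2 first.
  - apply/measurable_EFinP; exact: measurable_indic.
  - by rewrite lee_fin.
  by rewrite integral_indic// setIT EFinM fineK// fin_num_measure.
by under [in RHS]eq_bigr do rewrite ci; rewrite sumEFin.
Qed.

(** Monotone convergence from simple functions. The inequality form, with any bound [V] on the mean,
    is what Chernoff's method consumes. *)
Lemma iid_prod_le (f : d.-tuple R -> R) (V : R) : measurable_fun setT f ->
  (forall x, 0 <= f x) -> (\int[L]_x (f x)%:E <= V%:E)%E ->
  (\int[P]_a (\prod_j f (W j a))%:E <= (V ^+ m)%:E)%E.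
Proof.
have [mW lW iW] := hW; move=> mf f0 fV.
have mf' : measurable_fun setT (EFin \o f) by exact/measurable_EFinP.
pose h n := nnsfun_approx measurableT mf' n.
have hcvg x : h n x @[n --> \oo] --> f x.
  have := @cvg_nnsfun_approx _ _ _ _ measurableT _ mf' (fun x _ => f0 x) x I.
  by move=> /fine_cvg.
have hnd x (n k : nat) : (n <= k)%N -> h n x <= h k x.
  by move=> nk; have /lefP := nd_nnsfun_approx measurableT mf' nk; exact.
have h0 n x : 0 <= h n x by exact: fun_ge0.
have hf n x : h n x <= f x.
  rewrite -(cvg_lim _ (hcvg x))//; apply: limr_ge; first by apply/cvg_ex; exists (f x).
  by near=> k; apply: hnd; near: k; exists n.
pose g n a : \bar R := (\prod_j h n (W j a))%:E.
have mg n : measurable_fun setT (g n).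
  apply/measurable_EFinP; apply: measurable_prod => j _.
  by apply: measurableT_comp => //; exact: mW.
have g0 n a : (0 <= g n a)%E by rewrite lee_fin prodr_ge0.
have gnd a : {homo g^~ a : n k / (n <= k)%N >-> (n <= k)%E}.
  move=> n k nk; rewrite lee_fin; apply: ler_prod => j _.
  by rewrite h0 hnd.
have glim a : limn (g^~ a) = (\prod_j f (W j a))%:E.
  apply/cvg_lim => //; apply: cvg_EFin; first exact: nearW.
  rewrite /g /=.
  elim: (index_enum _) => [|j r IH].
    rewrite big_nil (_ : fine \o _ = fun=> 1); first exact: cvg_cst.
    by apply/funext => n /=; rewrite big_nil.
  rewrite big_cons (_ : fine \o _ = (fun n => h n (W j a)) * (fun n => \prod_(i <- r) h n (W i a))).
    exact: cvgM (hcvg _) IH.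
  by apply/funext => n /=; rewrite big_cons.
under eq_integral do rewrite -glim.
rewrite monotone_convergence//.
apply: lime_le.
  apply: ereal_nondecreasing_is_cvgn => n k nk.
  by apply: ge0_le_integral => // a _; exact: gnd.
apply: nearW => n; rewrite /g iid_nnsfun lee_fin.
have hV : (\int[L]_x (h n x)%:E <= V%:E)%E.
  apply: le_trans fV; apply: ge0_le_integral => //.
  - by move=> x _; rewrite lee_fin.
  - exact/measurable_EFinP.
  - by move=> x _; rewrite lee_fin.
have hI0 : (0 <= \int[L]_x (h n x)%:E)%E by apply: integral_ge0 => x _; rewrite lee_fin.
have hfin : (\int[L]_x (h n x)%:E)%E \is a fin_num.
  by rewrite ge0_fin_numE// (le_lt_trans hV)// ltry.
have hV' : fine (\int[L]_x (h n x)%:E)%E <= V by rewrite -lee_fin fineK.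
by apply: lerXn2r => //; rewrite nnegrE ?fine_ge0// (le_trans _ hV')// fine_ge0.
Unshelve. all: by end_near. Qed.

Hypothesis m0 : (0 < m)%N.

(* Chernoff's bound with [lam] the smaller of [1 / (2 b)] and [sqrt (u / m) / v]. *)
Lemma bernstein (xi : d.-tuple R -> R) (v b u : R) : measurable_fun setT xi ->
  0 < v -> 0 < b -> 0 < u ->
  (forall n, (2 <= n)%N ->
    (\int[L]_x (`|xi x| ^+ n)%:E <= (n`!%:R / 2 * (v ^+ 2 * b ^+ (n - 2)))%:E)%E) ->
  (P [set a | (\int[L]_x xi x + (2 * v * Num.sqrt (u / m%:R) + 2 * b * (u / m%:R))
       <= m%:R^-1 * \sum_j xi (W j a))%R]
   <= (expR (- u))%:E)%E.
Proof.
have [mW lW iW] := hW; move=> mxi v0 b0 u0 mom.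
have m0R : 0 < m%:R :> R by rewrite ltr0n.
set r := u / m%:R; have r0 : 0 < r by rewrite divr_gt0.
have rE : r = Num.sqrt r ^+ 2 by rewrite sqr_sqrtr// ltW.
have uE : u = m%:R * r by rewrite /r mulrC divfK// gt_eqF.
set q := Num.sqrt r in rE *; have q0 : 0 < q by rewrite sqrtr_gt0.
set mu := \int[L]_x xi x; set thr := 2 * v * q + 2 * b * r.
have [lam [lam0 lamb lamr]] : exists lam : R,
    [/\ 0 < lam, lam * b <= 2^-1 & r <= lam * thr - lam ^+ 2 * v ^+ 2].
  have [qb|qb] := leP (q / v) (2 * b)^-1.
    exists (q / v); split; first exact: divr_gt0.
      by move: qb; rewrite -[(2 * b)^-1]div1r ler_pdivlMr ?mulr_gt0//; lra.
    have -> : q / v * thr - (q / v) ^+ 2 * v ^+ 2 = q ^+ 2 + 2 * (q / v) * b * r.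
      by rewrite /thr; field; rewrite gt_eqF.
    by rewrite -rE lerDl ltW// !mulr_gt0// invr_gt0.
  exists (2 * b)^-1; split; first by rewrite invr_gt0 mulr_gt0.
    by rewrite invfM mulfVK// gt_eqF.
  move: qb; rewrite ltr_pdivlMr// => qb.
  have -> : (2 * b)^-1 * thr - (2 * b)^-1 ^+ 2 * v ^+ 2
      = r + (2 * b)^-1 * v * (2 * q - (2 * b)^-1 * v).
    by rewrite /thr; field; rewrite gt_eqF.
  have h : 0 < (2 * b)^-1 * v by rewrite mulr_gt0// invr_gt0 mulr_gt0.
  by rewrite lerDl mulr_ge0//; lra.
(* The tilt is normalised so that [f] has mean at most [expR (- r)] while the product of the
   [f (W j a)] is at least 1 on the event; Markov's inequality follows. *)
pose f x := expR (lam * xi x) * expR (- (lam * (mu + thr))).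
have mex : measurable_fun setT (fun x => expR (lam * xi x)).
  by apply: measurableT_comp => //; exact: measurable_funM.
have mf : measurable_fun setT f by exact: measurable_funM.
have f0 x : 0 <= f x by rewrite mulr_ge0 ?expR_ge0.
have fV : (\int[L]_x (f x)%:E <= (expR (- r))%:E)%E.
  under eq_integral do rewrite /f mulrC EFinM.
  rewrite ge0_integralZl//; last exact/measurable_EFinP.
  apply: le_trans (lee_wpmul2l _ (mgf_le mxi b0 (ltW lam0) lamb mom)) _.
    by rewrite lee_fin expR_ge0.
  by rewrite -EFinM -expRD lee_fin ler_expR -/mu; lra.
set E := [set a | _].
have mavg : measurable_fun setT (fun a => m%:R^-1 * \sum_j xi (W j a)).
  apply: measurable_funM => //; apply: measurable_sum => j.
  by apply: measurableT_comp => //; exact: mW.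
have mE : measurable E.
  by rewrite -[E]setTI; apply: measurable_fun_le.
have -> : expR (- u) = expR (- r) ^+ m by rewrite -expRM_natl mulrN -uE.
apply: le_trans (iid_prod_le mf f0 fV).
rewrite -[X in P X]setIT -integral_indic//.
apply: ge0_le_integral => //.
- by apply/measurable_EFinP; exact: measurable_indic.
- apply/measurable_EFinP; apply: measurable_prod => j _.
  by apply: measurableT_comp => //; exact: mW.
move=> a _; rewrite lee_fin indicE.
case: (boolP (a \in E)) => [/set_mem aE|_]; last by rewrite prodr_ge0.
rewrite (eq_bigr (fun j => expR (lam * xi (W j a) - lam * (mu + thr)))); last first.
  by move=> j _; rewrite /f -expRD.
rewrite -expR_sum -[leLHS]expR0 ler_expR sumrB -mulr_sumr sumr_const card_ord.
rewrite -mulr_natl subr_ge0 mulrCA ler_pM2l//.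
by move: aE; rewrite /E /= ler_pdivlMl.
Qed.

End Independence.

(** * Trigonometric estimates for difference quotients *)

Section Trigonometry.
Variable R : realType.
Implicit Types x y h : R.

Lemma cos_lipschitz x y : `|cos x - cos y| <= `|x - y|.
Proof.
wlog yx : x y / y <= x.
  move=> H; have [/H//|/ltW/H] := leP y x.
  by rewrite distrC [leRHS]distrC.
have dc z : z \in `]y, x[ -> is_derive z 1 (@cos R) (- sin z) by move=> _; exact: is_derive_cos.
have cc : {within `[y, x], continuous (@cos R)}.
  by apply: continuous_subspaceT => z; exact: continuous_cos.
have [c _ ->] := MVT_segment yx dc cc.
by rewrite normrM normrN; apply: ler_piMl => //; exact: sin_max.
Qed.

(** By the mean value theorem [rho] is a cosine at an intermediate point. It replaces [sin x / x]
    without a case distinction at 0. *)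
Lemma sin_factor x : exists2 rho, sin x = x * rho & `|rho| <= 1 /\ `|rho - 1| <= `|x|.
Proof.
have key y : 0 <= y -> exists2 rho, sin y = y * rho & `|rho| <= 1 /\ `|rho - 1| <= `|y|.
  move=> y0.
  have dc z : z \in `]0, y[ -> is_derive z 1 (@sin R) (cos z) by move=> _; exact: is_derive_sin.
  have cc : {within `[0, y], continuous (@sin R)}.
    by apply: continuous_subspaceT => z; exact: continuous_sin.
  have [c + e] := MVT_segment y0 dc cc; rewrite in_itv /= => /andP[c0 cy].
  exists (cos c); first by move: e; rewrite sin0 !subr0 mulrC.
  split; first exact: cos_max.
  rewrite -[1]cos0; apply: le_trans (cos_lipschitz _ _) _.
  by rewrite subr0 !ger0_norm.
have [x0|/ltW x0] := leP 0 x; first exact: key.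
have x0' : 0 <= - x by rewrite oppr_ge0.
have [rho e [r1 r2]] := key _ x0'.
exists rho; first by apply: oppr_inj; rewrite -sinN e mulNr.
by split=> //; rewrite -[`|x|]normrN.
Qed.

(** A difference of cosines is again a multiple of a shifted cosine, so cosines with amplitude and
    phase are closed under difference quotients. *)
Lemma cosD_diff (t u : R) : cos (t + u) - cos t = 2 * sin (u / 2) * cos (t + (u / 2 + pi / 2)).
Proof.
rewrite addrA cosDpihalf sinD.
have ue : u = u / 2 + u / 2 by field.
rewrite {1}ue addrA cosD (cosD t) (sinD t).
have := cos2Dsin2 (u / 2).
move: (cos t) (sin t) (cos (u / 2)) (sin (u / 2)) => a b c s h.
apply/eqP; rewrite -subr_eq0.
have -> : (a * c - b * s) * c - (b * c + a * s) * s - a - 2 * s * - (b * c + a * s)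
    = a * (c ^+ 2 + s ^+ 2 - 1) by ring.
by rewrite h subrr mulr0.
Qed.

End Trigonometry.

(** * Iterated partial derivatives and difference quotients *)

Section Derivatives.
Context {R : realType} {d : nat}.
Implicit Types (f g : 'rV[R]_d -> R) (x y v c : 'rV[R]_d) (s r : seq 'I_d).
Local Notation e i := (delta_mx 0 i : 'rV[R]_d).

Lemma diff_quot_shift f c x v :
  (fun h => h^-1 *: (((fun y => f (c + y)) \o shift x) (h *: v) - f (c + x)))
  = (fun h => h^-1 *: ((f \o shift (c + x)) (h *: v) - f (c + x))).
Proof. by apply/funext => h /=; rewrite addrCA. Qed.

Lemma derivable_shift f c x v :
  derivable (fun y => f (c + y)) x v = derivable f (c + x) v.
Proof. by rewrite /derivable diff_quot_shift. Qed.

Lemma derive_shift f c x v : 'D_v (fun y => f (c + y)) x = 'D_v f (c + x).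
Proof. by rewrite /derive diff_quot_shift. Qed.

(** With [Dseq_diff], this moves a difference quotient inside an iterated derivative, so that an
    outer derivative can be traded for a change of the function differentiated. *)
Lemma Dseq_shift s f c : Dok s f ->
  Dok s (fun y => f (c + y)) /\ Dseq s (fun y => f (c + y)) = fun y => Dseq s f (c + y).
Proof.
elim: s => [//|i s IH] /= [/IH[ok E] der]; split; last first.
  by apply/funext => y; rewrite /partial E derive_shift.
by split=> // y; rewrite E derivable_shift.
Qed.

Lemma Dseq_diff s f g (a : R) : Dok s f -> Dok s g ->
  Dok s (fun y => a * (f y - g y)) /\
  Dseq s (fun y => a * (f y - g y)) = fun y => a * (Dseq s f y - Dseq s g y).
Proof.
elim: s => [//|i s IH] /= [/IH H df] [/H[ok E] dg].
have der x : is_derive x (e i) (fun y => a * (Dseq s f y - Dseq s g y))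
    (a * ('D_(e i) (Dseq s f) x - 'D_(e i) (Dseq s g) x)).
  exact: (is_deriveZ a (is_deriveB (derivableP (df x)) (derivableP (dg x)))).
split; last by apply/funext => y; rewrite /partial E; exact: derive_val.
by split=> // x; rewrite E; exact: ex_derive.
Qed.

(** The derivative is assumed to exist, so it inherits any bound uniform over small steps; no limit
    has to be exchanged with an integral. *)
Lemma derive_near f x v (I B delta : R) : 0 < delta -> derivable f x v ->
  (forall h, h != 0 -> `|h| <= delta -> `|h^-1 * (f (h *: v + x) - f x) - I| <= B) ->
  `|'D_v f x - I| <= B.
Proof.
move=> d0 der H.
have c1 : `|h^-1 *: ((f \o shift x) (h *: v) - f x) - I| @[h --> 0^'] --> `|'D_v f x - I|.
  by apply: cvg_norm; apply: cvgB; [exact: der|exact: cvg_cst].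
rewrite -(cvg_lim _ c1)//; apply: limr_le; first by apply/cvg_ex; exists `|'D_v f x - I|.
near=> h; apply: H.
  by near: h; exact: nbhs_dnbhs_neq.
rewrite -[h]subr0 distrC; near: h; apply: nbhs_dnbhs.
by exists delta => // y /ltW.
Unshelve. all: by end_near. Qed.

End Derivatives.

(** * Derivatives of the random features as phase shifts *)

Section Spectral.
Context {R : realType} {d : nat}.
Implicit Types (w : d.-tuple R) (x y z : 'rV[R]_d) (s r : seq 'I_d) (p q : d.-tuple nat).
Local Notation e i := (delta_mx 0 i : 'rV[R]_d).

Lemma dotvD w x y : dotv w (x + y) = dotv w x + dotv w y.
Proof. by rewrite /dotv -big_split /=; apply: eq_bigr => i _; rewrite mxE mulrDr. Qed.

Lemma dotvN w x : dotv w (- x) = - dotv w x.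
Proof. by rewrite /dotv -sumrN; apply: eq_bigr => i _; rewrite mxE mulrN. Qed.

Lemma dotvB w x y : dotv w (x - y) = dotv w x - dotv w y.
Proof. by rewrite dotvD dotvN. Qed.

Lemma dotv_e w (h : R) i : dotv w (h *: e i) = tnth w i * h.
Proof.
rewrite /dotv (bigD1 i)//= big1 ?addr0 => [|j ji]; rewrite !mxE eqxx /=.
  by rewrite mulr1.
by rewrite (negbTE ji) mulr0 mulr0.
Qed.

Lemma tnorm2_ge0 w : 0 <= tnorm2 w.
Proof. exact: sqrtr_ge0. Qed.

Lemma tnth_le_tnorm2 w i : `|tnth w i| <= tnorm2 w.
Proof.
rewrite -sqrtr_sqr ler_wsqrtr// (bigD1 i)//= lerDl sumr_ge0// => j _; exact: sqr_ge0.
Qed.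

Lemma measurable_dotv x : measurable_fun setT (fun w => dotv w x).
Proof.
by apply: measurable_sum => i; apply: measurable_funM => //; exact: measurable_tnth.
Qed.

Lemma measurable_tnorm2 : measurable_fun setT (@tnorm2 R d).
Proof.
have -> : @tnorm2 R d = (@Num.sqrt R) \o (fun w : d.-tuple R => \sum_i tnth w i ^+ 2) by [].
apply: measurableT_comp.
  by apply: continuous_measurable_fun; exact: sqrt_continuous.
by apply: measurable_sum => i; apply: measurable_funX; exact: measurable_tnth.
Qed.

Lemma measurable_mono p : measurable_fun setT (fun w => mono w p).
Proof. by apply: measurable_prod => i _; apply: measurable_funX; exact: measurable_tnth. Qed.

Lemma measurable_cosT {dT : measure_display} {T : measurableType dT} (f : T -> R) :
  measurable_fun setT f -> measurable_fun setT (fun t => cos (f t)).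
Proof.
apply: (measurableT_comp (f := @cos R)).
by apply: continuous_measurable_fun; exact: continuous_cos.
Qed.

Lemma measurable_sinT {dT : measure_display} {T : measurableType dT} (f : T -> R) :
  measurable_fun setT f -> measurable_fun setT (fun t => sin (f t)).
Proof.
apply: (measurableT_comp (f := @sin R)).
by apply: continuous_measurable_fun; exact: continuous_sin.
Qed.

Lemma derive_cos_dotv w (A c : R) i z :
  'D_(e i) (fun z => A * cos (dotv w z + c)) z
  = A * tnth w i * cos (dotv w z + (c + pi / 2)).
Proof.
set t := dotv w z + c.
(* In the direction [e i] the difference quotients are those of [G], a function of one variable. *)
pose G (h : R) := A * cos (h * tnth w i + t).
have H : is_derive (0 : R) (1 : R) G (A * (- sin t * tnth w i)).
  have h1 : is_derive (0 : R) (1 : R) (fun h : R => h * tnth w i + t) (tnth w i).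
    have := is_deriveD (is_deriveM (is_derive_id (0 : R) (1 : R))
      (is_derive_cst (tnth w i) (0 : R) (1 : R))) (is_derive_cst t (0 : R) (1 : R)).
    rewrite scaler0 add0r addr0 -[X in is_derive _ _ _ X -> _]/(_ * _) mulr1.
    exact.
  have h2 : is_derive ((fun h : R => h * tnth w i + t) 0) 1 (@cos R) (- sin t).
    by rewrite /= mul0r add0r; exact: is_derive_cos.
  have h3 : is_derive (0 : R) (1 : R) (@cos R \o (fun h : R => h * tnth w i + t))
    (- sin t * tnth w i) by exact: is_derive1_comp.
  by have := @is_deriveZ R R R _ A _ _ _ h3.
have E : (fun h : R => h^-1 *: (((fun z => A * cos (dotv w z + c)) \o shift z) (h *: e i)
      - A * cos t))
    = (fun h : R => h^-1 *: ((G \o shift 0) (h *: (1 : R)) - G 0)).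
  apply/funext => h; rewrite /G /= addr0 mul0r add0r dotvD dotv_e -addrA -/t.
  by rewrite [h *: 1]mulr1 [h * _]mulrC.
rewrite /derive E -[LHS]/('D_1 G 0) (@derive_val _ _ _ _ _ _ _ H).
by rewrite addrA cosDpihalf -/t mulrAC mulrA.
Qed.

Lemma Dseq_cos s w (c : R) :
  Dseq s (fun z => cos (dotv w z + c))
  = fun z => (\prod_(i <- s) tnth w i) * cos (dotv w z + (c + (size s)%:R * (pi / 2))).
Proof.
elim: s => [|i s IH] /=.
  by apply/funext => z; rewrite big_nil mul1r mul0r addr0.
rewrite IH; apply/funext => z; rewrite /partial big_cons derive_cos_dotv.
rewrite [X in X * _]mulrC -natr1; congr (_ * cos _); ring.
Qed.

Lemma prod_dseq w p : \prod_(i <- dseq p) tnth w i = mono w p.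
Proof.
rewrite /dseq big_flatten /= big_map big_enum /mono /=.
by apply: eq_bigr => i _; rewrite big_nseq iter_mulr_1.
Qed.

Lemma mono_addmi w p q : mono w (addmi p q) = mono w p * mono w q.
Proof.
by rewrite /mono -big_split /=; apply: eq_bigr => i _; rewrite tnth_mktuple exprD.
Qed.

(* The kernel derivative and its estimate are means of [spec p q z w]: each
   derivative of a cosine shifts its phase by [pi / 2]. *)
Definition spec p q z w :=
  mono w (addmi p q) *
  cos (dotv w z + ((size (dseq p))%:R - (size (dseq q))%:R) * (pi / 2)).

Lemma khatE m (W : 'I_m -> d.-tuple R) p q x y :
  khat W p q x y = m%:R^-1 * \sum_(j < m) spec p q (x - y) (W j).
Proof.
rewrite /khat; congr (_ * _); apply: eq_bigr => j _.
set w := W j.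
have cosE : (fun z => cos (dotv w z)) = (fun z => cos (dotv w z + 0)).
  by apply/funext => z; rewrite addr0.
(* Sine is a cosine of phase [- pi / 2], so [Dseq_cos] handles both features; [cosB] then recombines
   them into a function of [x - y]. *)
have sinE : (fun z => sin (dotv w z)) = (fun z => cos (dotv w z + (- (pi / 2)))).
  apply/funext => z; rewrite -[in LHS](subrK (pi / 2) (dotv w z)) sinDpihalf//.
rewrite /Dmulti cosE sinE !Dseq_cos !prod_dseq /spec mono_addmi dotvB.
set a := (size (dseq p))%:R * _; set b := (size (dseq q))%:R * _.
have -> : dotv w x - dotv w y + ((size (dseq p))%:R - (size (dseq q))%:R) * (pi / 2)
    = (dotv w x + a) - (dotv w y + b) by rewrite /a /b; ring.
rewrite cosB !add0r.
have sE t u : cos (t + (- (pi / 2) + u)) = sin (t + u) :> R.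
  by rewrite addrCA addrC -[in RHS](subrK (pi / 2) (t + u)) sinDpihalf.
rewrite !sE; ring.
Qed.

End Spectral.

(** * The kernel derivative as a spectral integral *)

Section KernelDerivative.
Context {R : realType} {d : nat}.
Variable L : probability (d.-tuple R) R.
Implicit Types (w : d.-tuple R) (x y z : 'rV[R]_d) (s r : seq 'I_d) (p q : d.-tuple nat).
Implicit Types (a b Q : d.-tuple R -> R) (c delta h sg : R).
Local Notation e i := (delta_mx 0 i : 'rV[R]_d).

(** The phase depends on [w] because each difference quotient shifts it by a multiple of a
    coordinate of [w]. *)
Definition spectral_mean a b z : R := \int[L]_w (a w * cos (dotv w z + b w)).

(* [a w * cos (t + b w)] is what [n] difference quotients of steps at most
   [delta] make of a cosine; the corresponding derivative is [Q w * cos (t + c)]. *)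
Definition diff_approx delta (n : nat) a b Q c :=
  [/\ measurable_fun setT a, measurable_fun setT b,
      exists M, forall w, `|a w| <= M, forall w, `|a w| <= `|Q w| &
      forall w t, `|a w * cos (t + b w) - Q w * cos (t + c)|
        <= `|Q w| * (n%:R * delta * tnorm2 w)].

Lemma diff_approx0 delta : diff_approx delta 0 (fun=> 1) (fun=> 0) (fun=> 1) 0.
Proof.
split=> //; first by exists 1 => w; rewrite normr1.
by move=> w t; rewrite subrr normr0 !mul0r mulr0.
Qed.

(** The effect of one difference quotient on amplitude and phase, by [cosD_diff]. The sign [sg] is 1
    for a step in [x] and -1 for a step in [y], since the kernel depends on [x - y]. *)
Definition stepA h i a w := a w * (2 * sin (tnth w i * h / 2) / h).
Definition stepB sg h i b w := b w + sg * (tnth w i * h / 2 + pi / 2).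

(** One more quotient costs [delta * tnorm2 w]: half for replacing [rho] by 1 in the amplitude, half
    for dropping [tnth w i * h / 2] from the phase. *)
Lemma diff_approxS sg h i delta n a b Q c : sg = 1 \/ sg = -1 -> h != 0 -> `|h| <= delta ->
  diff_approx delta n a b Q c ->
  diff_approx delta n.+1 (stepA h i a) (stepB sg h i b)
    (fun w => Q w * tnth w i) (c + sg * (pi / 2)).
Proof.
move=> sg1 h0 hd [ma mb [M aM] aQ H].
have nsg : `|sg| = 1 by case: sg1 => ->; rewrite ?normrN normr1.
have mt : measurable_fun setT (fun w : d.-tuple R => tnth w i) by exact: measurable_tnth.
have mth : measurable_fun setT (fun w : d.-tuple R => tnth w i * h / 2).
  by apply: measurable_funM => //; exact: measurable_funM.
have fac w : exists2 rho, 2 * sin (tnth w i * h / 2) / h = tnth w i * rho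
    & `|rho| <= 1 /\ `|rho - 1| <= delta * tnorm2 w / 2.
  have [rho -> [r1 r2]] := sin_factor (tnth w i * h / 2).
  exists rho; first by field.
  split=> //; apply: le_trans r2 _.
  rewrite !normrM normfV (ger0_norm (ler0n R 2)) ler_wpM2r ?invr_ge0// mulrC.
  by apply: ler_pM => //; exact: tnth_le_tnorm2.
split.
- apply: measurable_funM => //; apply: measurable_funM => //; apply: measurable_funM => //.
  exact: measurable_sinT.
- by apply: measurable_funD => //; apply: measurable_funM => //; exact: measurable_funD.
- exists (M * (2 / `|h|)) => w.
  rewrite normrM; apply: ler_pM => //.
  rewrite !normrM normfV (ger0_norm (ler0n R 2)) ler_wpM2r ?invr_ge0//.
  by apply: ler_piMr => //; exact: sin_max.
- move=> w; rewrite /stepA; have [rho -> [r1 _]] := fac w.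
  rewrite !normrM; apply: ler_pM => //.
  by apply: ler_piMr.
move=> w t; rewrite /stepA /stepB; have [rho -> [r1 r2]] := fac w.
set v := tnth w i; set N := tnorm2 w.
pose t1 := t + sg * (v * h / 2 + pi / 2).
have -> : t + (b w + sg * (v * h / 2 + pi / 2)) = t1 + b w by rewrite /t1; ring.
have -> : a w * (v * rho) * cos (t1 + b w) - Q w * v * cos (t + (c + sg * (pi / 2)))
    = v * rho * (a w * cos (t1 + b w) - Q w * cos (t1 + c))
      + Q w * v * ((rho - 1) * cos (t1 + c) + (cos (t1 + c) - cos (t + (c + sg * (pi / 2))))).
  by ring.
apply: le_trans (ler_normD _ _) _; rewrite !normrM.
have h1 := H w t1.
have h2 : `|rho - 1| * `|cos (t1 + c)| <= delta * N / 2.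
  by apply: le_trans r2; apply: ler_piMr => //; exact: cos_max.
have h3 : `|cos (t1 + c) - cos (t + (c + sg * (pi / 2)))| <= delta * N / 2.
  apply: le_trans (cos_lipschitz _ _) _.
  have -> : t1 + c - (t + (c + sg * (pi / 2))) = sg * (v * h / 2) by rewrite /t1; ring.
  rewrite !normrM nsg mul1r normfV (ger0_norm (ler0n R 2)) ler_wpM2r ?invr_ge0//.
  by rewrite mulrC; apply: ler_pM => //; exact: tnth_le_tnorm2.
have h4 : `|(rho - 1) * cos (t1 + c) + (cos (t1 + c) - cos (t + (c + sg * (pi / 2))))|
    <= delta * N.
  apply: le_trans (ler_normD _ _) _; rewrite normrM; lra.
have h5 : `|v| * `|rho| * `|a w * cos (t1 + b w) - Q w * cos (t1 + c)|
    <= `|v| * (`|Q w| * (n%:R * delta * N)).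
  by apply: ler_pM => //; exact: ler_piMr.
have h6 := ler_wpM2l (mulr_ge0 (normr_ge0 (Q w)) (normr_ge0 v)) h4.
apply: le_trans (lerD h5 h6) _.
by rewrite -natr1 le_eqVlt; apply/orP; left; apply/eqP; ring.
Qed.

Lemma integrable_mul_cos a b z : measurable_fun setT a -> measurable_fun setT b ->
  L.-integrable setT (EFin \o a) ->
  L.-integrable setT (EFin \o (fun w => a w * cos (dotv w z + b w))).
Proof.
move=> ma mb ia.
have mc : measurable_fun setT (fun w => cos (dotv w z + b w)).
  by apply: measurable_cosT; apply: measurable_funD => //; exact: measurable_dotv.
apply: (@integrable_le _ _ _ L _ (fun w => `|a w|)); first exact: measurable_funM.
  by move=> w; rewrite normrM; apply: ler_piMr => //; exact: cos_max.
exact: integrable_norm.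
Qed.

(** Amplitudes of difference quotients are bounded for fixed steps, so the integrals can be
    subtracted with no moment assumption. *)
Lemma spectral_mean_diff sg h i delta n a b Q c z : sg = 1 \/ sg = -1 -> h != 0 ->
  diff_approx delta n a b Q c ->
  h^-1 * (spectral_mean a b (z + (sg * h) *: e i) - spectral_mean a b z)
  = spectral_mean (stepA h i a) (stepB sg h i b) z.
Proof.
move=> sg1 h0 [ma mb [M aM] _ _].
have ia : L.-integrable setT (EFin \o a).
  by apply: (@integrable_le _ _ _ L _ (fun=> M)) => //; exact: integrable_cst1.
have ii z' := integrable_mul_cos z' ma mb ia.
rewrite /spectral_mean -RintegralB// -RintegralZl//; last exact: integrableBR.
apply: eq_Rintegral => w _; rewrite /stepA /stepB dotvD dotv_e -mulrBr.
set v := tnth w i; set t := dotv w z.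
have key : cos (t + b w + sg * (v * h)) - cos (t + b w)
    = 2 * sin (v * h / 2) * cos (t + b w + sg * (v * h / 2 + pi / 2)).
  case: sg1 => ->; rewrite ?mul1r ?mulN1r ?cosD_diff//.
  rewrite mulNr sinN opprD !addrA.
  set u := t + b w - v * h / 2.
  have -> : cos (u - pi / 2) = - cos (u + pi / 2).
    by rewrite cosDpihalf opprK -[in RHS](subrK (pi / 2) u) sinDpihalf.
  ring.
have -> : t + v * (sg * h) + b w = t + b w + sg * (v * h) by ring.
have -> : t + (b w + sg * (v * h / 2 + pi / 2)) = t + b w + sg * (v * h / 2 + pi / 2) by ring.
rewrite key; field; exact: h0.
Qed.

Lemma spectral_mean_near delta n a b Q c z : diff_approx delta n a b Q c ->
  measurable_fun setT Q -> L.-integrable setT (EFin \o Q) ->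
  L.-integrable setT (EFin \o (fun w => `|Q w| * tnorm2 w)) ->
  `|spectral_mean a b z - \int[L]_w (Q w * cos (dotv w z + c))|
    <= n%:R * delta * \int[L]_w (`|Q w| * tnorm2 w).
Proof.
move=> [ma mb [M aM] _ H] mQ iQ iQN.
have ia : L.-integrable setT (EFin \o a).
  by apply: (@integrable_le _ _ _ L _ (fun=> M)) => //; exact: integrable_cst1.
have i1 := integrable_mul_cos z ma mb ia.
have i2 := integrable_mul_cos z mQ (measurable_cst c) iQ.
rewrite /spectral_mean -RintegralB//; apply: le_trans (le_normr_Rintegral _ _) _ => //.
  exact: integrableBR.
rewrite -RintegralZl//; apply: le_Rintegral => //.
- by apply: integrable_norm => //; exact: integrableBR.
- exact: integrableZR.
move=> w _; apply: le_trans (H w (dotv w z)) _.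
by rewrite le_eqVlt; apply/orP; left; apply/eqP; ring.
Qed.

(** The outermost derivative is approximated by quotients; each moves inside and makes [f] another
    spectral mean, to which the induction applies. Hence the generalisation over [f], [a] and [b],
    with the final amplitude [Qt] and phase [ct] fixed from the start. *)
Lemma Dseq_near_y delta r x y : 0 < delta ->
  forall n a b Q c Qt ct f, diff_approx delta n a b Q c ->
  (forall w, Qt w = Q w * \prod_(i <- r) tnth w i) -> ct = c - (size r)%:R * (pi / 2) ->
  measurable_fun setT Qt -> L.-integrable setT (EFin \o Qt) ->
  L.-integrable setT (EFin \o (fun w => `|Qt w| * tnorm2 w)) ->
  (forall y, f y = spectral_mean a b (x - y)) -> Dok r f ->
  `|Dseq r f y - \int[L]_w (Qt w * cos (dotv w (x - y) + ct))|
    <= (n + size r)%:R * delta * \int[L]_w (`|Qt w| * tnorm2 w).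
Proof.
move=> d0; elim: r => [|i r IH] n a b Q c Qt ct f H QE cE mQ iQ iQN fE.
  have {}QE : Qt = Q by apply/funext => w; rewrite QE big_nil mulr1.
  rewrite cE mul0r subr0 addn0 => _ /=; rewrite fE QE.
  by apply: spectral_mean_near; rewrite -?QE//; move: H; rewrite QE.
move=> [ok der] /=.
apply: (derive_near d0 (der y)) => h h0 hd.
have [_ E1] := Dseq_shift (h *: e i) ok.
have [ok2 E2] := Dseq_diff h^-1 (Dseq_shift (h *: e i) ok).1 ok.
have -> : h^-1 * (Dseq r f (h *: e i + y) - Dseq r f y)
    = Dseq r (fun y => h^-1 * (f (h *: e i + y) - f y)) y by rewrite E2 E1.
have sg1 : (-1 : R) = 1 \/ (-1 : R) = -1 by right.
(* One derivative has become one quotient, so [n + size r] is unchanged. *)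
rewrite -addSnnS; apply: (IH _ _ _ _ _ _ _ _ (diff_approxS i sg1 h0 hd H)) => //.
- by move=> w; rewrite QE big_cons mulrA.
- by rewrite cE /= -natr1; ring.
move=> y'; rewrite !fE -(spectral_mean_diff i (x - y') sg1 h0 H); congr (_ * (spectral_mean _ _ _ - _)).
by rewrite mulN1r scaleNr opprD addrA addrAC.
Qed.

(** The derivatives in [x] are the outer ones and are traded first; once none is left, [Dseq_near_y]
    takes over with the quotients accumulated so far. *)
Lemma Dseq_near_xy delta s r x y : 0 < delta ->
  forall n a b Q c Qt ct (k : 'rV[R]_d -> 'rV[R]_d -> R), diff_approx delta n a b Q c ->
  (forall w, Qt w = Q w * ((\prod_(i <- s) tnth w i) * \prod_(i <- r) tnth w i)) ->
  ct = c + ((size s)%:R - (size r)%:R) * (pi / 2) ->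
  measurable_fun setT Qt -> L.-integrable setT (EFin \o Qt) ->
  L.-integrable setT (EFin \o (fun w => `|Qt w| * tnorm2 w)) ->
  (forall x y, k x y = spectral_mean a b (x - y)) ->
  (forall x, Dok r (k x)) -> (forall y, Dok s (fun x => Dseq r (k x) y)) ->
  `|Dseq s (fun x => Dseq r (k x) y) x - \int[L]_w (Qt w * cos (dotv w (x - y) + ct))|
    <= (n + size s + size r)%:R * delta * \int[L]_w (`|Qt w| * tnorm2 w).
Proof.
move=> d0; elim: s => [|i s IH] n a b Q c Qt ct k H QE cE mQ iQ iQN kE okr oks.
  rewrite addn0; apply: (Dseq_near_y y d0 H) => //.
  - by move=> w; rewrite QE big_nil mul1r.
  - by rewrite cE sub0r mulNr.
have [ok der] := oks y.
apply: (derive_near d0 (der x)) => h h0 hd.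
pose F x := Dseq r (k x) y.
pose k' x y := h^-1 * (k (h *: e i + x) y - k x y).
have k'E x' : Dok r (k' x') /\
    Dseq r (k' x') = fun y => h^-1 * (Dseq r (k (h *: e i + x')) y - Dseq r (k x') y).
  exact: Dseq_diff.
have okF y' : Dok s (fun x => Dseq r (k x) y') by have [] := oks y'.
have dF y' := Dseq_diff h^-1 (Dseq_shift (h *: e i) (okF y')).1 (okF y').
have FE y' : (fun x => Dseq r (k' x) y')
    = (fun x => h^-1 * (Dseq r (k (h *: e i + x)) y' - Dseq r (k x) y')).
  by apply/funext => x'; rewrite (k'E x').2.
have -> : h^-1 * (Dseq s F (h *: e i + x) - Dseq s F x)
    = Dseq s (fun x => Dseq r (k' x) y) x.
  by rewrite FE (dF y).2 (Dseq_shift (h *: e i) (okF y)).2.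
have sg1 : (1 : R) = 1 \/ (1 : R) = -1 by left.
rewrite -(addSnnS n); apply: (IH _ _ _ _ _ _ _ _ (diff_approxS i sg1 h0 hd H)) => //.
- by move=> w; rewrite QE big_cons !mulrA.
- by rewrite cE /= -natr1; ring.
- move=> x' y'; rewrite /k' !kE -(spectral_mean_diff i (x' - y') sg1 h0 H).
  by congr (_ * (spectral_mean _ _ _ - _)); rewrite mul1r -addrA addrC.
- by move=> x'; exact: (k'E x').1.
- by move=> y'; rewrite FE; exact: (dF y').1.
Qed.

(* The iterated limits of difference quotients defining [Dpq] are all controlled
   by one bound in the largest step, so no moment of intermediate order is needed. *)
Lemma Dpq_spec p q (k : 'rV[R]_d -> 'rV[R]_d -> R) :
  (forall x y, (k x y)%:E = (\int[L]_w (cos (dotv w (x - y)))%:E)%E) ->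
  Dpq_exists p q k ->
  L.-integrable setT (EFin \o (fun w => mono w (addmi p q))) ->
  L.-integrable setT (EFin \o (fun w => `|mono w (addmi p q)| * tnorm2 w)) ->
  forall x y, Dpq p q k x y = \int[L]_w spec p q (x - y) w.
Proof.
move=> hk [ok1 ok2] i1 i2 x y.
have kE x' y' : k x' y' = spectral_mean (fun=> 1) (fun=> 0) (x' - y').
  rewrite /spectral_mean /Rintegral -[LHS]/(fine (k x' y')%:E) hk; congr fine.
  by apply: eq_integral => w _; rewrite mul1r addr0.
set J := \int[L]_w (`|mono w (addmi p q)| * tnorm2 w).
have J0 : 0 <= J by apply: Rintegral_ge0 => w _; rewrite mulr_ge0// tnorm2_ge0.
pose N : R := (size (dseq p) + size (dseq q))%:R.
have key delta : 0 < delta ->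
    `|Dpq p q k x y - \int[L]_w spec p q (x - y) w| <= N * delta * J.
  move=> d0.
  apply: (Dseq_near_xy x y d0 (diff_approx0 delta) _ _ _ i1 i2 kE ok1 ok2).
  - by move=> w; rewrite mul1r !prod_dseq mono_addmi.
  - by rewrite add0r.
  - exact: measurable_mono.
apply/eqP; rewrite -subr_eq0 -normr_eq0; apply: contraT => ne.
set D := `|_| in ne key; have D0 : 0 < D by rewrite lt_def ne normr_ge0.
have NJ : 0 <= N * J by rewrite mulr_ge0.
(* With this [delta] the bound falls below [D / 2], contradicting [D > 0]; the added 1 covers
   [N * J = 0]. *)
have dd : 0 < D / (2 * (N * J + 1)) by rewrite divr_gt0// mulr_gt0//; lra.
have := key _ dd.
have -> : N * (D / (2 * (N * J + 1))) * J = D * (N * J / (2 * (N * J + 1))).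
  by field; rewrite gt_eqF//; lra.
rewrite -[X in X <= _]mulr1 ler_pM2l// ler_pdivlMr; last by lra.
lra.
Qed.

End KernelDerivative.

(** * Union bounds and deviations of empirical means *)

Lemma measure_bigsetU_le {R : realType} {dT : measure_display} {T : measurableType dT}
    (P : probability T R) {I : Type} (s : seq I) (A : I -> set T) :
  (forall i, measurable (A i)) ->
  measurable (\big[setU/set0]_(i <- s) A i) /\
  (P (\big[setU/set0]_(i <- s) A i) <= \sum_(i <- s) P (A i))%E.
Proof.
move=> mA; elim: s => [|i s [IHm IH]]; first by rewrite !big_nil measure0.
rewrite !big_cons; split; first exact: measurableU.
by apply: le_trans (measureU2 _ (mA i) IHm) _; rewrite leeD2l.
Qed.

Lemma notin_bigsetU {T : Type} {I : eqType} (s : seq I) (A : I -> set T) (a : T) :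
  ~ (\big[setU/set0]_(i <- s) A i) a -> forall i, i \in s -> ~ A i a.
Proof.
elim: s => [//|j s IH]; rewrite big_cons => /not_orP[nj ns] i.
by rewrite inE => /orP[/eqP->//|]; exact: IH.
Qed.

Section Chaining.
Context {R : realType} {d : nat} {d0 : measure_display} {Omega : measurableType d0}.
Variables (P : probability Omega R) (m : nat) (W : 'I_m -> Omega -> d.-tuple R).
Variable L : probability (d.-tuple R) R.
Hypotheses (hW : iid_law P W L) (m0 : (0 < m)%N).
Implicit Types f h : d.-tuple R -> R.

Definition dev (f : d.-tuple R -> R) (a : Omega) : R :=
  m%:R^-1 * \sum_j f (W j a) - \int[L]_w f w.

Lemma devB f h a : L.-integrable setT (EFin \o f) -> L.-integrable setT (EFin \o h) ->
  dev (fun w => f w - h w) a = dev f a - dev h a.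
Proof.
by move=> fi hi; rewrite /dev RintegralB// sumrB mulrBr; ring.
Qed.

Lemma dev_telescope (f : nat -> d.-tuple R -> R) h n a :
  L.-integrable setT (EFin \o h) -> (forall s, L.-integrable setT (EFin \o f s)) ->
  L.-integrable setT (EFin \o (fun w => h w - \sum_(s < n) f s w)) /\
  dev h a = \sum_(s < n) dev (f s) a + dev (fun w => h w - \sum_(s < n) f s w) a.
Proof.
move=> hi fi; elim: n => [|n [IHi IH]].
  have -> : (fun w => h w - \sum_(s < 0) f s w) = h by apply/funext => w; rewrite big_ord0 subr0.
  by rewrite big_ord0 add0r.
have E : (fun w => h w - \sum_(s < n.+1) f s w)
    = (fun w => (h w - \sum_(s < n) f s w) - f n w).
  by apply/funext => w; rewrite big_ord_recr /= opprD addrA.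
rewrite E; split; first exact: integrableBR.
by rewrite devB// IH big_ord_recr /=; ring.
Qed.

(** Both the empirical and the true mean of [f] are dominated by those of [h]. A whole family below
    one [h] is thus handled by the upper deviation of that single function. *)
Lemma dev_abs_le f h a : L.-integrable setT (EFin \o f) -> L.-integrable setT (EFin \o h) ->
  (forall w, `|f w| <= h w) -> `|dev f a| <= dev h a + 2 * \int[L]_w h w.
Proof.
move=> fi hi fh.
have i1 : `|\int[L]_w f w| <= \int[L]_w h w.
  apply: le_trans (le_normr_Rintegral _ _) _ => //.
  by apply: le_Rintegral => //; exact: integrable_norm.
have i2 : `|m%:R^-1 * \sum_j f (W j a)| <= m%:R^-1 * \sum_j h (W j a).
  rewrite normrM ger0_norm ?invr_ge0// ler_wpM2l ?invr_ge0//.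
  by apply: le_trans (ler_norm_sum _ _ _) _; exact: ler_sum.
apply: le_trans (ler_normB _ _) _; rewrite /dev; lra.
Qed.

Lemma measurable_avg f : measurable_fun setT f ->
  measurable_fun setT (fun a => m%:R^-1 * \sum_j f (W j a)).
Proof.
have [mW _ _] := hW; move=> mf.
apply: measurable_funM => //; apply: measurable_sum => j.
by apply: measurableT_comp => //; exact: mW.
Qed.

Lemma bernstein_dev f (v b u : R) : measurable_fun setT f -> 0 < v -> 0 < b -> 0 < u ->
  (forall n, (2 <= n)%N ->
    (\int[L]_x (`|f x| ^+ n)%:E <= (n`!%:R / 2 * (v ^+ 2 * b ^+ (n - 2)))%:E)%E) ->
  exists A, [/\ measurable A, (P A <= (expR (- u))%:E)%E &
    forall a, ~ A a -> dev f a <= 2 * v * Num.sqrt (u / m%:R) + 2 * b * (u / m%:R)].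
Proof.
move=> mf v0 b0 u0 mom; eexists; split; last 2 first.
- exact: (bernstein hW m0 mf v0 b0 u0 mom).
- by move=> a /negP; rewrite -ltNge /dev => /ltW; rewrite lerBlDl.
rewrite -[X in measurable X]setTI; apply: measurable_fun_le => //.
exact: measurable_avg.
Qed.

Lemma bernstein_dev_abs f (v b u : R) : measurable_fun setT f -> 0 < v -> 0 < b -> 0 < u ->
  (forall n, (2 <= n)%N ->
    (\int[L]_x (`|f x| ^+ n)%:E <= (n`!%:R / 2 * (v ^+ 2 * b ^+ (n - 2)))%:E)%E) ->
  exists A, [/\ measurable A, (P A <= (2 * expR (- u))%:E)%E &
    forall a, ~ A a -> `|dev f a| <= 2 * v * Num.sqrt (u / m%:R) + 2 * b * (u / m%:R)].
Proof.
move=> mf v0 b0 u0 mom.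
have fi : L.-integrable setT (EFin \o f).
  apply: integrable_sqr => //.
  under eq_integral do rewrite -real_normK ?num_real//.
  exact: le_lt_trans (mom 2%N isT) (ltry _).
have [A [mA PA HA]] := bernstein_dev mf v0 b0 u0 mom.
have mNf : measurable_fun setT (fun w => - f w) by exact: measurableT_comp.
have momN n : (2 <= n)%N ->
    (\int[L]_x (`|- f x| ^+ n)%:E <= (n`!%:R / 2 * (v ^+ 2 * b ^+ (n - 2)))%:E)%E.
  by move=> n2; under eq_integral do rewrite normrN; exact: mom.
have [B [mB PB HB]] := bernstein_dev mNf v0 b0 u0 momN.
have dN a : dev (fun w => - f w) a = - dev f a.
  rewrite /dev; have -> : \int[L]_w (- f w) = - \int[L]_w f w.
    by rewrite -mulN1r -RintegralZl//; apply: eq_Rintegral => w _; rewrite mulN1r.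
  by rewrite sumrN mulrN opprB opprK addrC.
exists (A `|` B); split.
- exact: measurableU.
- apply: le_trans (measureU2 _ mA mB) _.
  by apply: le_trans (leeD PA PB) _; rewrite -EFinD lee_fin; lra.
move=> a /not_orP[/HA h1 /HB]; rewrite dN => h2.
by rewrite ler_norml h1 andbT; lra.
Qed.

(** * Truncated chaining for a class with envelope [Y] and Lipschitz factor [Y * N] *)

Variables (g : 'rV[R]_d -> d.-tuple R -> R) (Y N : d.-tuple R -> R) (K kap rho t D : R).
Variable net : nat -> seq 'rV[R]_d.
Hypotheses (mg : forall z, measurable_fun setT (g z)) (mY : measurable_fun setT Y)
  (mN : measurable_fun setT N) (Y0 : forall w, 0 <= Y w) (N0 : forall w, 0 <= N w)
  (gY : forall z w, `|g z w| <= Y w)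
  (gN : forall z z' w, `|g z w - g z' w| <= Y w * (N w * vnorm2 (z - z')))
  (Y2 : (\int[L]_w (Y w ^+ 2)%:E <= 1)%E)
  (YN2 : (\int[L]_w (Y w ^+ 2 * (kap * N w) ^+ 2)%:E <= 1)%E)
  (mom : forall n, (2 <= n)%N ->
    (\int[L]_w (Y w ^+ n)%:E <= (n`!%:R / 2 * K ^+ (n - 2))%:E)%E)
  (K0 : 0 < K) (kap0 : 0 < kap) (t0 : 0 < t) (D0 : 0 < D) (expD : expR (- D) <= 2^-1)
  (net_size : forall s, (size (net s))%:R <= expR (D * s.+2%:R))
  (net_cover : forall s z, vnorm2 z <= rho ->
    exists2 x, x \in net s & vnorm2 (z - x) <= kap * 2^-1 ^+ s.+2).

Let v (s : nat) : R := 2^-1 ^+ s.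
(** Two thirds of [3 D (s + 2)] pay for the pairs of net points of level [s]; the last third makes
    the failure probabilities summable over the levels. *)
Let u (s : nat) : R := 3 * D * s.+2%:R + t.
Let q (s : nat) : R := Num.sqrt (u s / m%:R).
Let al (s : nat) : R := v s / q s.

Let v_gt0 s : 0 < v s. Proof. by rewrite exprn_gt0// invr_gt0. Qed.
Let u_gt0 s : 0 < u s. Proof. by rewrite addr_gt0// !mulr_gt0. Qed.
Let q_gt0 s : 0 < q s. Proof. by rewrite sqrtr_gt0 divr_gt0// ltr0n. Qed.
Let al_gt0 s : 0 < al s. Proof. exact: divr_gt0. Qed.

(** The Lipschitz term of the minimum gives the second moment [v s ^ 2]; the constant 2 keeps the
    envelope below [2 Y], whose higher moments are controlled. Level 0 has no coarser point, hence
    [Y] itself. *)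
Definition incr_env (s : nat) (w : d.-tuple R) : R :=
  if s is 0 then Y w else Y w * Num.min 2 (N w * (kap * v s)).

Fixpoint kept (s : nat) (w : d.-tuple R) : bool :=
  if s is s'.+1 then kept s' w && (incr_env s' w <= al s') else true.

(* The envelope at the first level where the increments are truncated. *)
Fixpoint remainder (n : nat) (w : d.-tuple R) : R :=
  if n is n'.+1 then (if kept n w then incr_env n w else remainder n' w) else Y w.

(** The closeness test is part of the function, so the bounds hold for every pair and the union
    bound may run over all pairs of net points. [kept s.+1] tests the levels up to and including
    [s]. *)
Definition link (s : nat) (x : 'rV[R]_d * 'rV[R]_d) (w : d.-tuple R) : R :=
  if kept s.+1 w && ((s == 0%N) || (vnorm2 (x.1 - x.2) <= kap * v s))
  then g x.1 w - (if s == 0%N then 0 else g x.2 w) else 0.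

Let measurable_env s : measurable_fun setT (incr_env s).
Proof.
case: s => [|s] //; apply: measurable_funM => //.
by apply: measurable_minr => //; exact: measurable_funM.
Qed.

Let measurable_kept s : measurable_fun setT (kept s).
Proof.
elim: s => [|s IH] /=; first exact: measurable_cst.
by apply: measurable_and => //; exact: measurable_fun_ler.
Qed.

Let measurable_remainder n : measurable_fun setT (remainder n).
Proof.
elim: n => [//|n IH]; apply: measurable_fun_ifT => //; exact: measurable_kept.
Qed.

Let measurable_link s x : measurable_fun setT (link s x).
Proof.
apply: measurable_fun_ifT => //.
  by apply: measurable_and => //; exact: measurable_kept.
by apply: measurable_funB => //; case: (s == 0%N).
Qed.

Let env_ge0 s w : 0 <= incr_env s w.
Proof.
case: s => [//|s]; rewrite mulr_ge0// le_min ler0n /= !mulr_ge0// ?(ltW kap0)//.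
exact: ltW.
Qed.

Let env_le s w : incr_env s w <= 2 * Y w.
Proof.
case: s => [|s] /=; first by rewrite ler_peMl// ler1n.
by rewrite mulrC ler_wpM2r// ge_min lexx.
Qed.

Let increment_le s x y w : vnorm2 (x - y) <= kap * v s.+1 ->
  `|g x w - g y w| <= incr_env s.+1 w.
Proof.
move=> xy /=; have [_|_] := leP 2 (N w * (kap * v s.+1)).
  by apply: le_trans (ler_normB _ _) _; have := gY x w; have := gY y w; lra.
apply: le_trans (gN x y w) _; rewrite ler_wpM2l// ler_wpM2l//.
Qed.

Let link_le s x w : `|link s x w| <= incr_env s w.
Proof.
rewrite /link; case: ifP => [/andP[_]|_]; last by rewrite normr0 env_ge0.
by case: s => [|s] /=; [rewrite subr0|exact: increment_le].
Qed.

Let link_al s x w : `|link s x w| <= al s.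
Proof.
case: (boolP (kept s.+1 w)) => kw.
  by apply: le_trans (link_le s x w) _; move: kw => /= /andP[].
by rewrite /link (negbTE kw) normr0 ltW.
Qed.

Let env_sqr s : (\int[L]_w (incr_env s w ^+ 2)%:E <= (v s ^+ 2)%:E)%E.
Proof.
case: s => [|s]; first by rewrite /v expr0 expr1n.
apply: (@le_trans _ _ (\int[L]_w ((v s.+1 ^+ 2)%:E * (Y w ^+ 2 * (kap * N w) ^+ 2)%:E))%E).
  apply: ge0_le_integral => //.
  - by move=> w _; rewrite lee_fin sqr_ge0.
  - by apply/measurable_EFinP; exact: measurable_funX.
  - apply/measurable_EFinP; apply: measurable_funM => //; apply: measurable_funM.
      exact: measurable_funX.
    by apply: measurable_funX; exact: measurable_funM.
  move=> w _; rewrite -EFinM lee_fin /=.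
  have -> : v s.+1 ^+ 2 * (Y w ^+ 2 * (kap * N w) ^+ 2) = (Y w * (N w * (kap * v s.+1))) ^+ 2.
    by ring.
  rewrite ler_sqr ?nnegrE.
  - by rewrite ler_wpM2l// ge_min lexx orbT.
  - exact: (env_ge0 s.+1).
  - by rewrite !mulr_ge0// ltW.
rewrite ge0_integralZl//.
- by apply: le_trans (lee_wpmul2l _ YN2) _; rewrite ?mule1// lee_fin sqr_ge0.
- apply/measurable_EFinP; apply: measurable_funM; first exact: measurable_funX.
  by apply: measurable_funX; exact: measurable_funM.
- by move=> w _; rewrite lee_fin mulr_ge0// sqr_ge0.
- by rewrite lee_fin sqr_ge0.
Qed.

(** A function bounded by [al s] satisfies Bernstein's condition with that scale: all powers but two
    are bounded pointwise, and [n! / 2 >= 1]. *)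
Let link_moment s x n : (2 <= n)%N ->
  (\int[L]_w (`|link s x w| ^+ n)%:E <= (n`!%:R / 2 * (v s ^+ 2 * al s ^+ (n - 2)))%:E)%E.
Proof.
move=> n2.
have ml : measurable_fun setT (fun w => `|link s x w|).
  by apply: measurableT_comp => //; exact: normr_measurable.
apply: (@le_trans _ _ (\int[L]_w ((al s ^+ (n - 2))%:E * (incr_env s w ^+ 2)%:E))%E).
  apply: ge0_le_integral => //.
  - by apply/measurable_EFinP; exact: measurable_funX.
  - by apply/measurable_EFinP; apply: measurable_funM => //; exact: measurable_funX.
  move=> w _; rewrite -EFinM lee_fin -{1}(subnK n2) exprD.
  apply: ler_pM; rewrite ?exprn_ge0//.
  - by apply: lerXn2r; rewrite ?nnegrE// ltW.
  - by apply: lerXn2r; rewrite ?nnegrE.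
rewrite ge0_integralZl//; last 3 first.
- by apply/measurable_EFinP; exact: measurable_funX.
- by move=> w _; rewrite lee_fin sqr_ge0.
- by rewrite lee_fin exprn_ge0// ltW.
apply: le_trans (lee_wpmul2l _ (env_sqr s)) _; first by rewrite lee_fin exprn_ge0// ltW.
rewrite -EFinM lee_fin [leLHS]mulrC ler_peMl//.
  by rewrite mulr_ge0// ?sqr_ge0// exprn_ge0// ltW.
rewrite ler_pdivlMr// mul1r ler_nat; case: n n2 => [//|[//|n]] _.
by apply: leq_trans (fact_geq n.+2).
Qed.

Let remainderS n w : remainder n.+1 w =
  if kept n.+1 w then incr_env n.+1 w else remainder n w.
Proof. by []. Qed.

Let remainder_ge0 n w : 0 <= remainder n w.
Proof.
by elim: n => [|n IH]; [exact: Y0|rewrite remainderS; case: ifP => _; [exact: env_ge0|]].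
Qed.

Let remainder_le n w : remainder n w <= 2 * Y w.
Proof.
elim: n => [|n IH]; first by rewrite /= ler_peMl// ler1n.
by rewrite remainderS; case: ifP => _; [exact: env_le|].
Qed.

Let remainder_kept n w : kept n w -> remainder n w = incr_env n w.
Proof. by case: n => [//|n] kw; rewrite remainderS kw. Qed.

(** If [w] is first rejected at level [k], the remainder is [incr_env k w], which exceeds [al k] and
    so is at most its square divided by [al k]. If never rejected, it is the last envelope. *)
Let remainder_sum n w :
  remainder n w <= \sum_(s < n) incr_env s w ^+ 2 / al s + incr_env n w.
Proof.
have e0 k : 0 <= \sum_(s < k) incr_env s w ^+ 2 / al s.
  by apply: sumr_ge0 => s _; rewrite divr_ge0 ?sqr_ge0// ltW.
have nk k : ~~ kept k w -> remainder k w <= \sum_(s < k) incr_env s w ^+ 2 / al s.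
  elim: k => [//|k IH] nkw.
  rewrite remainderS (negbTE nkw) big_ord_recr [leRHS]/=.
  case: (boolP (kept k w)) => kw; last first.
    by apply: le_trans (IH kw) _; rewrite lerDl divr_ge0 ?sqr_ge0// ltW.
  rewrite remainder_kept//; apply: le_trans (_ : incr_env k w ^+ 2 / al k <= _); last first.
    by rewrite lerDr; exact: e0.
  move: nkw; rewrite [kept _ _]/= kw [_ && _]/= -ltNge => h.
  rewrite ler_pdivlMr// expr2; apply: ler_wpM2l; [exact: env_ge0|exact: ltW].
case: (boolP (kept n w)) => kw; first by rewrite remainder_kept// lerDr; exact: e0.
by apply: le_trans (nk _ kw) _; rewrite lerDl; exact: env_ge0.
Qed.

(** Since the remainder is at most [2 Y], the factor [2 ^ n] splits into [2 ^ 2] for the variance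
    and [2 ^ (n - 2)] for the scale [2 K]. *)
Let remainder_moment k n : (2 <= n)%N ->
  (\int[L]_w (`|remainder k w| ^+ n)%:E <= (n`!%:R / 2 * (2 ^+ 2 * (2 * K) ^+ (n - 2)))%:E)%E.
Proof.
move=> n2.
apply: (@le_trans _ _ (\int[L]_w ((2 ^+ n)%:E * (Y w ^+ n)%:E))%E).
  apply: ge0_le_integral => //.
  - apply/measurable_EFinP; apply: measurable_funX; apply: measurableT_comp => //.
  - by apply/measurable_EFinP; apply: measurable_funM => //; exact: measurable_funX.
  move=> w _; rewrite -EFinM lee_fin -exprMn; apply: lerXn2r; rewrite ?nnegrE//.
    by rewrite mulr_ge0.
  by rewrite ger0_norm.
rewrite ge0_integralZl//; last 2 first.
- by apply/measurable_EFinP; exact: measurable_funX.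
- by move=> w _; rewrite lee_fin exprn_ge0.
apply: le_trans (lee_wpmul2l _ (mom n2)) _; first by rewrite lee_fin exprn_ge0.
rewrite -EFinM lee_fin -{1}(subnK n2) exprD exprMn le_eqVlt; apply/orP; left; apply/eqP; ring.
Qed.

(** While [w] is kept, the links telescope to [g] at the last net point, within the next envelope of
    [g z]. From the first rejection on, the links vanish and the error is frozen, as is
    [remainder]. *)
Let chain_le n z w (x : nat -> 'rV[R]_d) :
  (forall s, vnorm2 (z - x s) <= kap * 2^-1 ^+ s.+2) ->
  `|g z w - \sum_(s < n) link s (x s, x s.-1) w| <= remainder n w.
Proof.
move=> zx.
have near s : vnorm2 (x s.+1 - x s) <= kap * v s.+1.
  have k0 : 0 <= kap * v s.+1 by rewrite mulr_ge0// ltW.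
  rewrite -ler_sqr ?nnegrE ?vnorm2_ge0//; apply: le_trans (sqr_vnorm2B _ _ z) _.
  have sq s' : vnorm2 (z - x s') ^+ 2 <= (kap * 2^-1 ^+ s'.+2) ^+ 2.
    by rewrite ler_sqr ?nnegrE ?vnorm2_ge0// mulr_ge0 ?exprn_ge0 ?invr_ge0// ltW.
  (* In units of [(kap * v s.+1) ^ 2] the bound is [2 (1/16 + 1/4) = 5/8]. *)
  have := sq s; have := sq s.+1; rewrite /v.
  have -> : (kap * 2^-1 ^+ s.+3) ^+ 2 = (kap * 2^-1 ^+ s.+1) ^+ 2 / 16.
    by rewrite (exprS _ s.+2) (exprS _ s.+1); field.
  have -> : (kap * 2^-1 ^+ s.+2) ^+ 2 = (kap * 2^-1 ^+ s.+1) ^+ 2 / 4.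
    by rewrite (exprS _ s.+1); field.
  have := sqr_ge0 (kap * 2^-1 ^+ s.+1); lra.
have tel k : kept k w ->
    \sum_(s < k) link s (x s, x s.-1) w = if k is k'.+1 then g (x k') w else 0.
  elim: k => [|k IH] kw; first by rewrite big_ord0.
  have kw' : kept k w by move: kw => /= /andP[].
  rewrite big_ord_recr [LHS]/= IH// /link kw andTb.
  case: k {IH kw kw'} => [|k]; first by rewrite add0r subr0.
  by rewrite /= near addrC subrK.
elim: n => [|n IH]; first by rewrite big_ord0 subr0; exact: gY.
rewrite remainderS; case: ifP => kw.
  rewrite tel//; apply: increment_le; apply: le_trans (zx n) _.
  rewrite ler_pM2l// /v exprS ler_piMl ?exprn_ge0 ?invr_ge0//.
  by rewrite invf_le1// ler1n.
by rewrite big_ord_recr /= {2}/link kw andFb addr0.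
Qed.

Let integrable_sqr_env s : L.-integrable setT (EFin \o (fun w => incr_env s w ^+ 2)).
Proof.
apply: integrable_ge0 => //; first exact: measurable_funX.
  by move=> w; exact: sqr_ge0.
exact: le_lt_trans (env_sqr s) (ltry _).
Qed.

Let Rintegral_sqr_env s : \int[L]_w (incr_env s w ^+ 2) <= v s ^+ 2.
Proof. by rewrite -lee_fin -EFin_Rintegral//; exact: env_sqr. Qed.

Let al_sum n : L.-integrable setT (EFin \o (fun w => \sum_(s < n) incr_env s w ^+ 2 / al s)) /\
  \int[L]_w (\sum_(s < n) incr_env s w ^+ 2 / al s) <= \sum_(s < n) v s * q s.
Proof.
elim: n => [|n [IHi IH]].
  have -> : (fun w => \sum_(s < 0) incr_env s w ^+ 2 / al s) = fun=> 0.
    by apply/funext => w; rewrite big_ord0.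
  by split; [exact: integrable_cst1|rewrite Rintegral_cst1 big_ord0].
have -> : (fun w => \sum_(s < n.+1) incr_env s w ^+ 2 / al s)
    = (fun w => \sum_(s < n) incr_env s w ^+ 2 / al s + (al n)^-1 * incr_env n w ^+ 2).
  by apply/funext => w; rewrite big_ord_recr /= [X in _ + X]mulrC.
have i2 := integrableZR (al n)^-1 (integrable_sqr_env n).
split; first exact: integrableDR.
rewrite RintegralD// RintegralZl// big_ord_recr /= lerD//.
apply: le_trans (ler_wpM2l _ (Rintegral_sqr_env n)) _; first by rewrite invr_ge0 ltW.
by rewrite /al le_eqVlt; apply/orP; left; apply/eqP; field; rewrite !gt_eqF.
Qed.

Let integrable_remainder n : L.-integrable setT (EFin \o remainder n).
Proof.
apply: integrable_sqr => //.
under eq_integral do rewrite -real_normK ?num_real//.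
exact: le_lt_trans (remainder_moment n (leqnn 2)) (ltry _).
Qed.

Let Rintegral_remainder n : \int[L]_w remainder n w <= \sum_(s < n) v s * q s + v n.
Proof.
have [i1 b1] := al_sum n.
(* The last envelope is bounded by [e <= e^2 / (2 v) + v / 2], so that its second moment alone
   yields the mean [v n]. *)
pose F w := \sum_(s < n) incr_env s w ^+ 2 / al s
  + ((2 * v n)^-1 * incr_env n w ^+ 2 + v n / 2).
have i2 := integrableZR (2 * v n)^-1 (integrable_sqr_env n).
have i3 : L.-integrable setT (EFin \o (fun w => (2 * v n)^-1 * incr_env n w ^+ 2 + v n / 2)).
  by apply: integrableDR => //; exact: integrable_cst1.
have iF : L.-integrable setT (EFin \o F) by exact: integrableDR.
apply: (@le_trans _ _ (\int[L]_w F w)).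
  apply: le_Rintegral => // w _; apply: le_trans (remainder_sum n w) _.
  rewrite lerD2l -subr_ge0.
  have -> : (2 * v n)^-1 * incr_env n w ^+ 2 + v n / 2 - incr_env n w
      = (2 * v n)^-1 * (incr_env n w - v n) ^+ 2 by field; rewrite gt_eqF.
  by rewrite mulr_ge0 ?sqr_ge0// invr_ge0 mulr_ge0// ltW.
rewrite RintegralD// RintegralD//; last exact: integrable_cst1.
rewrite Rintegral_cst1 RintegralZl//; apply: lerD => //.
have v20 : 0 <= (2 * v n)^-1 by rewrite invr_ge0 mulr_ge0// ltW.
have := ler_wpM2l v20 (Rintegral_sqr_env n).
have -> : (2 * v n)^-1 * v n ^+ 2 = v n / 2 by field; rewrite gt_eqF.
lra.
Qed.

(** At [s = 0] the second component is a dummy, drawn from [net 0] again and ignored by [link 0]. *)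
Let pairs s := [seq (x, y) | x <- net s, y <- net s.-1].

Let pairs_size s : (size (pairs s))%:R <= expR (2 * D * s.+2%:R).
Proof.
rewrite size_allpairs natrM.
have -> : 2 * D * s.+2%:R = D * s.+2%:R + D * s.+2%:R by ring.
rewrite expRD; apply: ler_pM => //; apply: le_trans (net_size _) _.
by rewrite ler_expR ler_pM2l// ler_nat !ltnS leq_pred.
Qed.

(** The links contribute 4 times the sum of the [v s * q s]; twice the mean of the remainder adds 2
    more and [2 v n], and its deviation gives the terms in [t]. Links and remainder each fail with
    probability at most [expR (- t)]. *)
Lemma chaining n : exists E, [/\ measurable E, (P E <= (2 * expR (- t))%:E)%E &
  forall a, ~ E a -> forall z, vnorm2 z <= rho ->
    `|dev (g z) a| <= 6 * \sum_(s < n) v s * q s + 2 * v n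
      + 4 * Num.sqrt (t / m%:R) + 4 * K * (t / m%:R)].
Proof.
have m0R : 0 < m%:R :> R by rewrite ltr0n.
have bad (sx : nat * ('rV[R]_d * 'rV[R]_d)) : exists A, [/\ measurable A,
    (P A <= (2 * expR (- u sx.1))%:E)%E &
    forall a, ~ A a -> `|dev (link sx.1 sx.2) a| <= 4 * (v sx.1 * q sx.1)].
  case: sx => s x /=.
  have [A [mA PA HA]] := bernstein_dev_abs (measurable_link s x) (v_gt0 s) (al_gt0 s)
    (u_gt0 s) (@link_moment s x).
  exists A; split=> // a /HA /le_trans; apply.
  (* Here the threshold pays off: [2 al q^2 = 2 v q], the same as the Gaussian term. *)
  have uE : u s / m%:R = q s ^+ 2 by rewrite sqr_sqrtr// divr_ge0// ltW.
  rewrite -/(q s) uE /al le_eqVlt; apply/orP; left; apply/eqP.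
  by field; rewrite gt_eqF.
have [B HB] := choice bad.
have K20 : 0 < 2 * K by rewrite mulr_gt0.
have [A [mA PA HA]] := bernstein_dev (measurable_remainder n) (ltr0n R 2) K20 t0
  (@remainder_moment n).
pose F s := \big[setU/set0]_(x <- pairs s) B (s, x).
have mB sx : measurable (B sx) by have [] := HB sx.
have FP s := measure_bigsetU_le P (pairs s) (fun x => mB (s, x)).
have [mF PF] := measure_bigsetU_le P (iota 0 n) (fun s => (FP s).1).
have PFs s : (P (F s) <= (expR (- t) * 2^-1 ^+ s.+1)%:E)%E.
  apply: le_trans (FP s).2 _.
  apply: (@le_trans _ _ (\sum_(x <- pairs s) (2 * expR (- u s))%:E)%E).
    by apply: lee_sum => x _; have [] := HB (s, x).
  rewrite sumEFin lee_fin big_const_seq count_predT iter_addr_0 -[leLHS]mulr_natl.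
  apply: le_trans (ler_wpM2r _ (pairs_size s)) _; first by rewrite mulr_ge0// expR_ge0.
  (* The entropy of the pairs cancels and [expR (- D) <= 1/2] leaves [2 * 2^-(s+2) = 2^-(s+1)]. *)
  have -> : expR (2 * D * s.+2%:R) * (2 * expR (- u s))
      = expR (- t) * (2 * expR (- D) ^+ s.+2).
    rewrite -expRM_natl mulrCA -expRD mulrCA -expRD; congr (_ * expR _).
    by rewrite /u; ring.
  rewrite ler_pM2l ?expR_gt0//.
  have : expR (- D) ^+ s.+2 <= 2^-1 ^+ s.+2.
    by apply: lerXn2r; rewrite ?nnegrE ?expR_ge0// invr_ge0.
  by rewrite (exprS 2^-1 s.+1); lra.
exists (A `|` \big[setU/set0]_(s <- iota 0 n) F s); split.
- exact: measurableU.
- apply: le_trans (measureU2 _ mA mF) _.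
  have -> : (2 * expR (- t))%:E = ((expR (- t))%:E + (expR (- t))%:E)%E :> \bar R.
    by rewrite -EFinD; congr _%:E; ring.
  apply: leeD => //; apply: le_trans PF _.
  apply: (@le_trans _ _ (\sum_(s <- iota 0 n) (expR (- t) * 2^-1 ^+ s.+1)%:E)%E).
    by apply: lee_sum => s _; exact: PFs.
  rewrite sumEFin lee_fin -mulr_sumr ler_piMr ?expR_ge0//.
  rewrite -[n in iota 0 n]subn0 -/(index_iota 0 n) sum_half_expn.
  by rewrite gerBl exprn_ge0// invr_ge0.
move=> a /not_orP[/HA devR nF] z zr.
have cover s : exists x, x \in net s /\ vnorm2 (z - x) <= kap * 2^-1 ^+ s.+2.
  by have [x xs zx] := net_cover s zr; exists x.
have [x xP] := choice cover.
have gi : L.-integrable setT (EFin \o g z).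
  apply: (@integrable_le _ _ _ L _ Y) => //.
  by apply: integrable_sqr => //; exact: le_lt_trans Y2 (ltry _).
have li s y : L.-integrable setT (EFin \o link s y).
  apply: (@integrable_le _ _ _ L _ (fun=> al s)) => //; exact: integrable_cst1.
have [ri ->] := @dev_telescope (fun s => link s (x s, x s.-1)) (g z) n a gi (fun s => li s _).
have b1 : `|\sum_(s < n) dev (link s (x s, x s.-1)) a| <= 4 * \sum_(s < n) v s * q s.
  rewrite mulr_sumr; apply: le_trans (ler_norm_sum _ _ _) _; apply: ler_sum => s _.
  have [_ _] := HB (nat_of_ord s, (x s, x s.-1)); apply.
  have sn : nat_of_ord s \in iota 0 n by rewrite mem_iota /=.
  apply: (notin_bigsetU (notin_bigsetU nF sn)).
  by apply: allpairs_f; have [] := xP s; have [] := xP s.-1.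
have b2 := dev_abs_le a ri (integrable_remainder n)
  (fun w => chain_le n w (fun s => (xP s).2)).
have b3 := Rintegral_remainder n.
apply: le_trans (ler_normD _ _) _.
move: devR b1 b2 b3; set S1 := \sum_(s < n) v s * q s.
set S2 := `|\sum_(s < n) _|; set S3 := `|dev _ _|; lra.
Qed.

End Chaining.

(** * Numerical constants and nets at every scale *)

Section Constants.
Variable R : realType.

(** The root is bounded by an affine function of [s], since [3 (s + 2) <= ((s + 5) / 2)^2] with
    equality at [s = 1]. As [2^-s] and [s 2^-s] both sum to 2, the total is
    [6 sqrt D + 2 sqrt t]. *)
Lemma level_sum_le (D t : R) (m n : nat) : (0 < m)%N -> 0 <= D -> 0 <= t ->
  \sum_(s < n) 2^-1 ^+ s * Num.sqrt ((3 * D * s.+2%:R + t) / m%:R)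
    <= (6 * Num.sqrt D + 2 * Num.sqrt t) / Num.sqrt m%:R.
Proof.
move=> m0 D0 t0.
have m0R : 0 < Num.sqrt m%:R :> R by rewrite sqrtr_gt0 ltr0n.
set A := Num.sqrt D; set B := Num.sqrt t.
have A0 : 0 <= A by exact: sqrtr_ge0.
have B0 : 0 <= B by exact: sqrtr_ge0.
have lev (s : nat) : Num.sqrt ((3 * D * s.+2%:R + t) / m%:R)
    <= (A * (s%:R + 5) / 2 + B) / Num.sqrt m%:R.
  have s0 : 0 <= s%:R :> R by [].
  rewrite sqrtrM; last by rewrite addr_ge0// !mulr_ge0.
  rewrite sqrtrV// ler_wpM2r ?invr_ge0 ?sqrtr_ge0//.
  rewrite -[leRHS]ger0_norm; last by rewrite addr_ge0// !mulr_ge0 ?addr_ge0.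
  rewrite -sqrtr_sqr ler_wsqrtr//.
  have -> : D = A ^+ 2 by rewrite sqr_sqrtr.
  have -> : t = B ^+ 2 by rewrite sqr_sqrtr.
  rewrite -[s.+2%:R]natr1 -[s.+1%:R]natr1 -subr_ge0.
  have -> : (A * (s%:R + 5) / 2 + B) ^+ 2 - (3 * A ^+ 2 * (s%:R + 1 + 1) + B ^+ 2)
      = A ^+ 2 * (s%:R - 1) ^+ 2 / 4 + A * B * (s%:R + 5) by field.
  apply: addr_ge0; last by apply: mulr_ge0; [exact: mulr_ge0|exact: addr_ge0].
  by apply: mulr_ge0; [apply: mulr_ge0; exact: sqr_ge0|rewrite invr_ge0].
have sumE : \sum_(s < n) 2^-1 ^+ s * (A * (s%:R + 5) / 2 + B)
    = 6 * A + 2 * B - 2^-1 ^+ n * (A * (n%:R + 6) + 2 * B).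
  elim: n => [|k IH]; first by rewrite big_ord0 expr0 mul1r; ring.
  by rewrite big_ord_recr /= IH exprS -natr1; field.
apply: (@le_trans _ _ (\sum_(s < n) 2^-1 ^+ s * ((A * (s%:R + 5) / 2 + B) / Num.sqrt m%:R))).
  by apply: ler_sum => s _; rewrite ler_wpM2l// exprn_ge0// invr_ge0.
under eq_bigr do rewrite mulrA.
rewrite -mulr_suml sumE ler_wpM2r ?invr_ge0 ?sqrtr_ge0// gerBl.
by rewrite mulr_ge0 ?exprn_ge0 ?invr_ge0// addr_ge0// mulr_ge0// addr_ge0.
Qed.

(** Chaining over [m.+1] levels leaves the residue [2 * 2^-(m+1) = 2^-m], which the summand 1 of the
    constant [C1] absorbs. *)
Lemma half_expn_le_sqrt (m : nat) : (0 < m)%N -> 2^-1 ^+ m <= (Num.sqrt m%:R)^-1 :> R.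
Proof.
move=> m0; have m1 : 1 <= m%:R :> R by rewrite ler1n.
have p0 : 0 < 2 ^+ m :> R by rewrite exprn_gt0.
have s0 : 0 < Num.sqrt m%:R :> R by rewrite sqrtr_gt0; lra.
rewrite exprVn lef_pV2 ?posrE//.
have -> : 2 ^+ m = Num.sqrt ((2 ^+ m) ^+ 2) :> R by rewrite sqrtr_sqr ger0_norm// exprn_ge0.
rewrite ler_wsqrtr// -natrX -natrX ler_nat.
apply: leq_trans (ltnW (ltn_expl m (ltnSn 1))) _.
by rewrite expnS expn1 leq_pmulr// expn_gt0.
Qed.

Lemma ln2_gt0_le1 : 0 < ln 2 :> R /\ ln 2 <= 1 :> R.
Proof.
split; first by rewrite ln_gt0// ltr1n.
by have -> : 2 = 1 + 1 :> R by []; apply: le_ln1Dx; lra.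
Qed.

(** The target [36 = 6 * 6] is the factor of [sqrt D] from chaining. The rational bounds [12/5] and
    [7/5], with [ln 2 <= 1], give [7 * (12/5) * (12/5) > 36]. *)
Lemma C3_ge : 36 <= 7 * Num.sqrt 6 * (1 + Num.sqrt pi / (ln 2) `^ (3 / 2)) :> R.
Proof.
have [l0 l1] := ln2_gt0_le1.
have p1 : 0 < (ln 2 : R) `^ (3 / 2) by exact: powR_gt0.
have p2 : (ln 2 : R) `^ (3 / 2) <= 1.
  rewrite /powR gt_eqF// -[leRHS]expR0 ler_expR; apply: mulr_ge0_le0; first by lra.
  exact: ln_le0.
have s6 : 12 / 5 <= Num.sqrt 6 :> R.
  have -> : 12 / 5 = Num.sqrt ((12 / 5) ^+ 2) :> R by rewrite sqrtr_sqr ger0_norm//; lra.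
  by rewrite ler_wsqrtr//; lra.
have sp : 7 / 5 <= Num.sqrt pi :> R.
  have -> : 7 / 5 = Num.sqrt ((7 / 5) ^+ 2) :> R by rewrite sqrtr_sqr ger0_norm//; lra.
  by rewrite ler_wsqrtr//; have := pi_ge2 R; lra.
have : 7 / 5 <= Num.sqrt pi / (ln 2) `^ (3 / 2) :> R.
  rewrite ler_pdivlMr//; nra.
nra.
Qed.

(** Compared term by term: [36 sqrt D] with [C3], the residue with [C1], and [(12 + 4) sqrt t] and
    [4 K t / m] with the last bracket. The positive [C2] term makes the inequality strict. *)
Lemma chaining_bound_lt (D t K : R) (m : nat) : (0 < m)%N -> 0 <= D -> 0 < t -> 1 <= K ->
  6 * \sum_(s < m.+1) 2^-1 ^+ s * Num.sqrt ((3 * D * s.+2%:R + t) / m%:R) + 2 * 2^-1 ^+ m.+1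
    + 4 * Num.sqrt (t / m%:R) + 4 * K * (t / m%:R)
  < 7 * Num.sqrt 6 * (1 + Num.sqrt pi / (ln 2) `^ (3 / 2)) * Num.sqrt D / Num.sqrt m%:R
    + (14 * Num.sqrt (6 * ln 2) + 1) / Num.sqrt m%:R + 36 * K * (ln 2 + 1) / m%:R
    + 24 * Num.sqrt 6 / Num.sqrt m%:R
      * (Num.sqrt t + Num.sqrt 6 * K / (2 * Num.sqrt m%:R) * t / 2).
Proof.
move=> m0 D0 t0 K1.
have m0R : 0 < m%:R :> R by rewrite ltr0n.
have h1 := level_sum_le m.+1 m0 D0 (ltW t0).
have h2 := half_expn_le_sqrt m0.
have h3 := C3_ge.
have [l0 _] := ln2_gt0_le1.
have t1 : Num.sqrt (t / m%:R) = Num.sqrt t / Num.sqrt m%:R.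
  by rewrite sqrtrM ?ltW// sqrtrV// ltW.
set r := Num.sqrt m%:R in h1 h2 t1 *.
have r0 : 0 < r by rewrite sqrtr_gt0.
have mE : m%:R = r ^+ 2 by rewrite sqr_sqrtr// ltW.
have s6 : Num.sqrt 6 ^+ 2 = 6 :> R by rewrite sqr_sqrtr.
have s61 : 1 <= Num.sqrt 6 :> R by rewrite -[leLHS]sqrtr1 ler_wsqrtr// ler1n.
have LE : 24 * Num.sqrt 6 / r * (Num.sqrt t + Num.sqrt 6 * K / (2 * r) * t / 2)
    = 24 * Num.sqrt 6 * (Num.sqrt t / r) + 36 * (K * (t / m%:R)).
  rewrite mE.
  have -> : 36 = 6 * Num.sqrt 6 ^+ 2 :> R by rewrite s6; ring.
  by field; rewrite gt_eqF.
rewrite LE t1.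
have a0 : 0 <= Num.sqrt D / r by rewrite divr_ge0 ?sqrtr_ge0// ltW.
have b0 : 0 <= Num.sqrt t / r by rewrite divr_ge0 ?sqrtr_ge0// ltW.
have c0 : 0 < r^-1 by rewrite invr_gt0.
have k0 : 0 <= K * (t / m%:R) by rewrite mulr_ge0 ?divr_ge0// ?ltW//; lra.
have c2 : 0 < 36 * K * (ln 2 + 1) / m%:R by rewrite divr_gt0// !mulr_gt0//; lra.
have c1 : r^-1 <= (14 * Num.sqrt (6 * ln 2) + 1) / r.
  by apply: ler_peMl; [exact: ltW|rewrite lerDr mulr_ge0// sqrtr_ge0].
have c3 : 36 * (Num.sqrt D / r) <= 7 * Num.sqrt 6 * (1 + Num.sqrt pi / (ln 2) `^ (3 / 2)) * Num.sqrt D / r.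
  by rewrite -[leRHS]mulrA ler_wpM2r.
have c4 : 24 * (Num.sqrt t / r) <= 24 * Num.sqrt 6 * (Num.sqrt t / r).
  by rewrite ler_wpM2r// ler_peMr.
have h1' : 6 * \sum_(s < m.+1) 2^-1 ^+ s * Num.sqrt ((3 * D * s.+2%:R + t) / m%:R)
    <= 36 * (Num.sqrt D / r) + 12 * (Num.sqrt t / r).
  have -> : 36 * (Num.sqrt D / r) + 12 * (Num.sqrt t / r)
      = 6 * ((6 * Num.sqrt D + 2 * Num.sqrt t) / r) by field; rewrite gt_eqF.
  by rewrite ler_pM2l.
have h2' : 2 * 2^-1 ^+ m.+1 <= r^-1 by rewrite exprS mulrA mulfV// mul1r.
have k1 : 4 * K * (t / m%:R) = 4 * (K * (t / m%:R)) by rewrite -!mulrA.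
lra.
Qed.

(* One net per level: the factor [2 ^ s] of the refined scale and the constants of
   [ball_net] are absorbed in a power of [16 rho C + 4 >= 4]. *)
Lemma level_net (d : nat) (rho C : R) (s : nat) : (0 < d)%N -> 0 <= rho -> 0 <= C ->
  exists N : seq 'rV[R]_d,
    (size N)%:R <= expR (d%:R * ln (16 * rho * C + 4) * s.+2%:R) /\
    forall z, vnorm2 z <= rho ->
      exists2 x, x \in N & vnorm2 (z - x) <= (C + (8 * (rho + 1))^-1)^-1 * 2^-1 ^+ s.+2.
Proof.
move=> d0 r0 C0.
have rC : 0 <= rho * C by rewrite mulr_ge0.
set Q := 16 * rho * C + 4; have Q4 : 4 <= Q by rewrite /Q; lra.
(* The shift adds at most [1/2] to [4 rho C], which the 1 in [M] covers. *)
set C' := C + _; have C'0 : 0 < C' by rewrite ltr_wpDl// invr_gt0; lra.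
have p0 : 0 < 2 ^+ s :> R by rewrite exprn_gt0.
have p1 : 1 <= 2 ^+ s :> R by rewrite exprn_ege1// ler1n.
have e0 : 0 < C'^-1 * 2^-1 ^+ s.+2 by rewrite mulr_gt0 ?invr_gt0// exprn_gt0// invr_gt0.
(* This value gives [2 + 2 M <= 2 ^ s Q], whence the form [16 rho C + 4]. *)
pose M := 2 ^+ s * (1 + 8 * (rho * C)).
have M0 : 0 < M by rewrite mulr_gt0//; lra.
have rM : rho <= M * (C'^-1 * 2^-1 ^+ s.+2).
  have -> : M * (C'^-1 * 2^-1 ^+ s.+2) = (1 + 8 * (rho * C)) / (4 * C').
    rewrite /M !exprS exprVn; field.
    by rewrite !gt_eqF.
  rewrite ler_pdivlMr ?mulr_gt0//.
  have -> : rho * (4 * C') = 4 * (rho * C) + 2^-1 * (rho / (rho + 1)).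
    by rewrite /C'; field; rewrite gt_eqF//; lra.
  have : rho / (rho + 1) <= 1 by rewrite ler_pdivrMr; lra.
  lra.
have [N [sN cN]] := ball_net d0 r0 e0 M0 rM.
exists N; split => //; apply: le_trans sN _.
have -> : d%:R * ln Q * s.+2%:R = d%:R * (s.+2%:R * ln Q) by ring.
rewrite expRM_natl; apply: lerXn2r; rewrite ?nnegrE ?expR_ge0//.
  by rewrite mulr_ge0 ?expR_ge0//; lra.
rewrite expRM_natl lnK ?posrE; last by lra.
(* Since [expR (- 1/2) >= 1/2], one has [expR (1/2) <= 2]. *)
have e4 : expR 1 <= 4 :> R.
  have h : expR (- 2^-1) * expR 2^-1 = 1 :> R by rewrite -expRD addNr expR0.
  have -> : expR 1 = expR 2^-1 ^+ 2 :> R by rewrite expr2 -expRD; congr expR; lra.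
  have := expR_ge1Dx (- 2^-1 : R); have := expR_gt0 (2^-1 : R); nra.
apply: (@le_trans _ _ (Q * (2 ^+ s * Q))).
  apply: ler_pM; rewrite ?expR_ge0//; [lra|lra|].
  by rewrite /M /Q; nra.
have -> : Q * (2 ^+ s * Q) = 2 ^+ s * Q ^+ 2 by ring.
rewrite -[s.+2]addn2 exprD; apply: ler_wpM2r; first exact: sqr_ge0.
by apply: lerXn2r; rewrite ?nnegrE//; lra.
Qed.

End Constants.

(** * The diameter of a compact set *)

Section Diameter.
Context {R : realType} {d : nat}.
Variable S : set 'rV[R]_d.
Hypothesis hS : compact S.

Lemma coord_le_norm (x : 'rV[R]_d) i : `|x ord0 i| <= `|x|.
Proof.
rewrite /Num.norm /= mx_normrE.
exact: (le_bigmax _ (fun ij => `|x ij.1 ij.2|) (ord0, i)).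
Qed.

(** Compactness bounds the set of distances, so that its [sup] is a genuine upper bound. *)
Lemma vnorm2_le_diam x y : S x -> S y -> vnorm2 (x - y) <= diam S.
Proof.
move=> Sx Sy; apply: ub_le_sup; last by exists x, y.
have [M [_ HM]] := compact_bounded hS.
have {}HM z : S z -> `|z| <= M + 1 by apply: HM; rewrite ltrDl.
exists (Num.sqrt (\sum_(i < d) (2 * (M + 1)) ^+ 2)) => _ [x' [y' [Sx' [Sy' ->]]]].
apply: ler_wsqrtr; apply: ler_sum => i _.
rewrite !mxE -real_normK ?num_real//.
have h1 := le_trans (coord_le_norm x' i) (HM _ Sx').
have h2 := le_trans (coord_le_norm y' i) (HM _ Sy').
have h3 := ler_normB (x' ord0 i) (y' ord0 i).
have h4 := normr_ge0 (x' ord0 i).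
by rewrite ler_sqr ?nnegrE//; lra.
Qed.

Lemma diam_ge0 : 0 <= diam S.
Proof.
have [->|/set0P[x Sx]] := eqVneq S set0; last first.
  by apply: le_trans (vnorm2_le_diam Sx Sx); exact: vnorm2_ge0.
rewrite /diam (_ : [set r | _] = set0) ?sup0//.
by apply/seteqP; split=> // r [x [y []]].
Qed.

End Diameter.

(** * Measurability of the supremum event *)

Section SupMeasurable.
Context {R : realType} {d : nat} {d0 : measure_display} {Omega : measurableType d0}.

(** Each sample path is Lipschitz in [z], so the supremum over the uncountable [Z] is reached along
    countably many points of [Z]. The Lipschitz constant may depend on [a], as it is used for one
    [a] at a time. *)
Lemma measurable_sup_event (Z : set 'rV[R]_d) (F : 'rV[R]_d -> Omega -> R)
    (lip : Omega -> R) (rho b : R) : (0 < d)%N -> 0 <= rho ->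
  (forall z, Z z -> vnorm2 z <= rho) -> (forall z, measurable_fun setT (F z)) ->
  (forall a z z', `|F z a - F z' a| <= lip a * vnorm2 (z - z')) ->
  measurable [set a | (b%:E <= ereal_sup [set `|F z a|%:E | z in Z])%E].
Proof.
move=> dpos r0 Zr mF lipF.
have [->|/set0P[z0 Zz0]] := eqVneq Z set0.
  rewrite (_ : [set a | _] = set0)//.
  by apply/seteqP; split=> // a /=; rewrite image_set0 ereal_sup0 leeNy_eq.
have dense (n : nat) : exists z : nat -> 'rV[R]_d, (forall i, Z (z i)) /\
    forall y, Z y -> exists i, vnorm2 (y - z i) ^+ 2 <= 4 * n.+1%:R^-1 ^+ 2.
  have e0 : 0 < n.+1%:R^-1 :> R by rewrite invr_gt0 ltr0n.
  have M0 : 0 < (rho + 1) * n.+1%:R by rewrite mulr_gt0//; lra.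
  have rM : rho <= (rho + 1) * n.+1%:R * n.+1%:R^-1.
    by rewrite mulfK ?pnatr_eq0//; lra.
  have [N [_ cN]] := ball_net dpos r0 e0 M0 rM.
  (* A net point may lie outside [Z]: it is replaced by a point of [Z] close to it, or by [z0] if
     there is none. Indices past the end of [N] read the default 0, which does no harm. *)
  have ch (i : nat) : exists z, Z z /\ forall y, Z y ->
      vnorm2 (y - nth 0 N i) <= n.+1%:R^-1 -> vnorm2 (y - z) ^+ 2 <= 4 * n.+1%:R^-1 ^+ 2.
    have [[z [Zz zN]]|no] := pselect (exists z, Z z /\ vnorm2 (z - nth 0 N i) <= n.+1%:R^-1).
      exists z; split=> // y Zy yN.
      have sym (u v : 'rV[R]_d) : vnorm2 (u - v) = vnorm2 (v - u).
        rewrite /vnorm2; congr Num.sqrt; apply: eq_bigr => j _.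
        by rewrite -[u - v]opprB mxE sqrrN.
      apply: le_trans (sqr_vnorm2B y z (nth 0 N i)) _; rewrite !(sym (nth 0 N i)).
      have sq u : vnorm2 (u - nth 0 N i) <= n.+1%:R^-1 ->
          vnorm2 (u - nth 0 N i) ^+ 2 <= n.+1%:R^-1 ^+ 2.
        by move=> h; rewrite ler_sqr ?nnegrE ?vnorm2_ge0// ltW.
      by move: (sq _ zN) (sq _ yN); move: (n.+1%:R^-1 ^+ 2) => E2; lra.
    by exists z0; split=> // y Zy yN; exfalso; apply: no; exists y.
  have [z zP] := choice ch.
  exists z; split=> [i|y Zy]; first by have [] := zP i.
  have [x xN yx] := cN y (Zr y Zy).
  exists (index x N); have [_ ] := zP (index x N); apply=> //.
  by rewrite nth_index.
have [z zP] := choice dense.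
have -> : [set a | (b%:E <= ereal_sup [set `|F z a|%:E | z in Z])%E]
    = \bigcap_j \bigcup_n \bigcup_i [set a | b - j.+1%:R^-1 < `|F (z n i) a|].
  apply/seteqP; split => a /=.
    move=> ba j _.
    have j0 : 0 < j.+1%:R^-1 :> R by rewrite invr_gt0 ltr0n.
    move: (j.+1%:R^-1) j0 => r rpos.
    have [_ [y Zy <-]] : exists2 y, [set `|F z a|%:E | z in Z] y & ((b - r)%:E < y)%E.
      by apply: ereal_sup_gt; apply: lt_le_trans ba; rewrite lte_fin; lra.
    rewrite lte_fin => Fy.
    have l0 : 0 <= `|lip a| by [].
    set gap := `|F y a| - (b - r).
    have g0 : 0 < gap by rewrite subr_gt0.
    (* At this resolution [F] varies by less than [gap] between [y] and its substitute, whose value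
       stays above [b - r]. *)
    have [n nP] : exists n : nat, 2 * `|lip a| / gap < n.+1%:R.
      exists (Num.truncn (2 * `|lip a| / gap)).
      by have /andP[] := @truncn_itv _ (2 * `|lip a| / gap)
           (divr_ge0 (mulr_ge0 (ler0n _ 2) l0) (ltW g0)).
    have [Zz zy] := zP n; have [i yi] := zy y Zy.
    exists n => //; exists i => //=.
    have yi' : vnorm2 (y - z n i) <= 2 * n.+1%:R^-1.
      rewrite -ler_sqr ?nnegrE ?vnorm2_ge0 ?mulr_ge0 ?invr_ge0//.
      by rewrite exprMn; apply: le_trans yi _; rewrite le_eqVlt; apply/orP; left; apply/eqP; ring.
    have Fd : `|F y a - F (z n i) a| < gap.
      apply: le_lt_trans (lipF a y (z n i)) _.
      apply: (@le_lt_trans _ _ (`|lip a| * (2 * n.+1%:R^-1))).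
        apply: le_trans (ler_wpM2r (vnorm2_ge0 _) (ler_norm (lip a))) _.
        by rewrite ler_wpM2l.
      move: nP; rewrite ltr_pdivrMr// => nP.
      by rewrite mulrA ltr_pdivrMr ?ltr0n// [_ * 2]mulrC [gap * _]mulrC.
    have := ler_distD 0 (F y a) (F (z n i) a).
    have := ler_normB (F y a - F (z n i) a) (- F (z n i) a).
    rewrite opprK subrK normrN.
    by move: Fd; rewrite /gap; lra.
  move=> H; apply/lee_addgt0Pr => e e0.
  have [j jP] : exists j : nat, j.+1%:R^-1 < e.
    exists (Num.truncn e^-1).
    have e1 : 0 < e^-1 by rewrite invr_gt0.
    have /andP[_ h] := truncn_itv (ltW e1).
    by rewrite -[X in _ < X]invrK ltf_pV2 ?posrE.
  have [n _ [i _ /= bF]] := H j I.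
  apply: (@le_trans _ _ (`|F (z n i) a|%:E + e%:E)%E).
    by rewrite -EFinD lee_fin; move: (j.+1%:R^-1) jP bF => r; lra.
  rewrite leeD2r//; apply: ereal_sup_ubound; exists (z n i) => //.
  by have [] := zP n.
apply: bigcap_measurableType => j _; apply: bigcup_measurable => n _.
apply: bigcup_measurable => i _.
rewrite (_ : [set a | _] = ~` [set a | `|F (z n i) a| <= b - j.+1%:R^-1]); last first.
  by apply/seteqP; split=> a /=; rewrite ltNge => /negP.
apply: measurableC; rewrite -[X in measurable X]setTI; apply: measurable_fun_le => //.
by apply: measurableT_comp => //; exact: normr_measurable.
Qed.

End SupMeasurable.

(** * The uniform deviation bound *)

Theorem theorem1 (R : realType) (d : nat) (hd : (0 < d)%N)
  (Lam : probability (d.-tuple R) R)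
  (k : 'rV[R]_d -> 'rV[R]_d -> R)
  (hk : forall x y, (k x y)%:E = (\int[Lam]_w (cos (dotv w (x - y)))%:E)%E)
  (p q : d.-tuple nat)
  (hder : Dpq_exists p q k)
  (hsig_pos : (0 < \int[Lam]_w ((mono w (addmi p q)) ^+ 2)%:E)%E)
  (hsig_fin : (\int[Lam]_w ((mono w (addmi p q)) ^+ 2)%:E < +oo)%E)
  (hC_fin : (\int[Lam]_w ((mono w (addmi p q)) ^+ 2 * tnorm2 w ^+ 2)%:E < +oo)%E)
  (K : R) (hK : 1 <= K)
  (hBern : forall n : nat, (2 <= n)%N ->
     (\int[Lam]_w ((`|mono w (addmi p q)|
         / Num.sqrt (fine (\int[Lam]_w' ((mono w' (addmi p q)) ^+ 2)%:E))) ^+ n)%:E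
      <= ((n`!)%:R / 2 * K ^+ (n - 2))%:E)%E)
  (m : nat) (hm : (0 < m)%N)
  (d0 : measure_display) (Omega : measurableType d0) (P : probability Omega R)
  (W : 'I_m -> Omega -> d.-tuple R) (hW : iid_law P W Lam)
  (t : R) (ht : 0 < t)
  (S : set 'rV[R]_d) (hS : compact S) :
  let sigma := Num.sqrt (fine (\int[Lam]_w ((mono w (addmi p q)) ^+ 2)%:E)) in
  let C := Num.sqrt (fine (\int[Lam]_w ((mono w (addmi p q)) ^+ 2 * tnorm2 w ^+ 2)%:E))
           / sigma in
  let Lm := Num.sqrt 6 * K / (2 * Num.sqrt m%:R) in
  let C1 := 14 * Num.sqrt (6 * ln 2) + 1 in
  let C2 := 36 * K * (ln 2 + 1) in
  let C3 := 7 * Num.sqrt 6 * (1 + Num.sqrt pi / (ln 2) `^ (3 / 2)) in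
  let bound := sigma * (C3 * Num.sqrt (d%:R * ln (16 * diam S * C + 4)) / Num.sqrt m%:R
                        + C1 / Num.sqrt m%:R + C2 / m%:R
                        + 24 * Num.sqrt 6 / Num.sqrt m%:R * (Num.sqrt t + Lm * t / 2)) in
  (P [set a | (bound%:E <=
        ereal_sup [set e | exists x y, S x /\ S y /\
                     e = (`|Dpq p q k x y - khat (fun j => W j a) p q x y|)%:E])%E]
   <= (2 * expR (- t))%:E)%E.
Proof.
pose sigma : R := Num.sqrt (fine (\int[Lam]_w ((mono w (addmi p q)) ^+ 2)%:E)).
pose C : R := Num.sqrt (fine (\int[Lam]_w ((mono w (addmi p q)) ^+ 2 * tnorm2 w ^+ 2)%:E))
           / sigma.
pose Lm : R := Num.sqrt 6 * K / (2 * Num.sqrt m%:R).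
pose C1 : R := 14 * Num.sqrt (6 * ln 2) + 1.
pose C2 : R := 36 * K * (ln 2 + 1).
pose C3 : R := 7 * Num.sqrt 6 * (1 + Num.sqrt pi / (ln 2) `^ (3 / 2)).
pose bound : R := sigma * (C3 * Num.sqrt (d%:R * ln (16 * diam S * C + 4)) / Num.sqrt m%:R
                        + C1 / Num.sqrt m%:R + C2 / m%:R
                        + 24 * Num.sqrt 6 / Num.sqrt m%:R * (Num.sqrt t + Lm * t / 2)).
suff: (P [set a | (bound%:E <=
        ereal_sup [set e | exists x y, S x /\ S y /\
                     e = (`|Dpq p q k x y - khat (fun j => W j a) p q x y|)%:E])%E]
   <= (2 * expR (- t))%:E)%E by [].
pose mn (w : d.-tuple R) := mono w (addmi p q).
have m0R : 0 < m%:R :> R by rewrite ltr0n.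
have mmn : measurable_fun setT mn by exact: measurable_mono.
have mtn : measurable_fun setT (@tnorm2 R d) by exact: measurable_tnorm2.
have sigma0 : 0 < sigma.
  rewrite sqrtr_gt0 fine_gt0//; apply/andP; split=> //; exact: hsig_fin.
set rho := diam S; have rho0 : 0 <= rho by exact: diam_ge0.
have C0 : 0 <= C by rewrite divr_ge0 ?sqrtr_ge0// ltW.
(* [C] can be 0, for instance when [Lam] is a point mass at the origin and [p = q = 0], while the
   net scale [C'^-1] requires a positive constant. *)
pose C' := C + (8 * (rho + 1))^-1.
have C'0 : 0 < C' by rewrite ltr_wpDl// invr_gt0; lra.
pose N (w : d.-tuple R) : R := tnorm2 w; pose Y (w : d.-tuple R) : R := `|mn w| / sigma.
pose g (z : 'rV[R]_d) (w : d.-tuple R) : R := spec p q z w / sigma.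
have mnorm : measurable_fun setT (fun w => `|mn w|).
  by apply: measurableT_comp => //; exact: normr_measurable.
have mY : measurable_fun setT Y by exact: measurable_funM.
have mspec z : measurable_fun setT (spec p q z).
  apply: measurable_funM; first exact: measurable_mono.
  by apply: measurable_cosT; apply: measurable_funD => //; exact: measurable_dotv.
have mg z : measurable_fun setT (g z).
  rewrite /g; apply: measurable_funM; [exact: mspec|exact: measurable_cst].
have Y0 w : 0 <= Y w by rewrite divr_ge0// ltW.
have gY z w : `|g z w| <= Y w.
  rewrite normrM normfV (gtr0_norm sigma0) ler_wpM2r ?invr_ge0 ?(ltW sigma0)//.
  by rewrite normrM ler_piMr// cos_max.
have spec_lip z z' w : `|spec p q z w - spec p q z' w| <= `|mn w| * N w * vnorm2 (z - z').
  rewrite /spec -mulrBr normrM -mulrA ler_wpM2l//.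
  apply: le_trans (cos_lipschitz _ _) _.
  by rewrite opprD addrACA subrr addr0 -dotvB; exact: dotv_le.
have gN z z' w : `|g z w - g z' w| <= Y w * (N w * vnorm2 (z - z')).
  rewrite /g -mulrBl normrM normfV (gtr0_norm sigma0) /Y mulrAC.
  by rewrite ler_wpM2r ?invr_ge0 ?(ltW sigma0)// mulrA.
have I2fin : (\int[Lam]_w ((mn w) ^+ 2 * tnorm2 w ^+ 2)%:E)%E \is a fin_num.
  by rewrite ge0_fin_numE// integral_ge0// => w _; rewrite lee_fin mulr_ge0 ?sqr_ge0.
(* At [n = 2] the right-hand side of Bernstein's condition is exactly 1. *)
have Ysq : (\int[Lam]_w (Y w ^+ 2)%:E <= 1)%E.
  by have := hBern 2%N isT; rewrite subnn expr0 mulr1 -[2`!]/2%N mulfV.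
have YN2 : (\int[Lam]_w (Y w ^+ 2 * (C'^-1 * N w) ^+ 2)%:E <= 1)%E.
  have -> : (\int[Lam]_w (Y w ^+ 2 * (C'^-1 * N w) ^+ 2)%:E
      = ((C' * sigma) ^- 2)%:E * \int[Lam]_w ((mn w) ^+ 2 * tnorm2 w ^+ 2)%:E)%E.
    rewrite -ge0_integralZl//.
    - apply: eq_integral => w _; rewrite -EFinM; congr _%:E.
      rewrite /Y expr_div_n real_normK ?num_real// /N.
      by field; rewrite !gt_eqF.
    - by apply/measurable_EFinP; apply: measurable_funM; exact: measurable_funX.
    - by move=> w _; rewrite lee_fin mulr_ge0 ?sqr_ge0.
    - by rewrite lee_fin invr_ge0 sqr_ge0.
  rewrite -[X in (_ * X)%E]fineK// -EFinM lee_fin.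
  have -> : fine (\int[Lam]_w ((mn w) ^+ 2 * tnorm2 w ^+ 2)%:E)%E = (C * sigma) ^+ 2.
    rewrite /C divfK ?gt_eqF// sqr_sqrtr// fine_ge0// integral_ge0// => w _.
    by rewrite lee_fin mulr_ge0 ?sqr_ge0.
  have CC' : C * sigma <= C' * sigma.
    by rewrite ler_pM2r// lerDl invr_ge0; lra.
  have Cs0 : 0 <= C * sigma by rewrite mulr_ge0// ltW.
  have C's0 : 0 < C' * sigma by rewrite mulr_gt0.
  rewrite mulrC ler_pdivrMr; last exact: exprn_gt0.
  by rewrite mul1r ler_sqr ?nnegrE// ltW.
have imn : Lam.-integrable setT (EFin \o mn) by exact: integrable_sqr.
have imnN : Lam.-integrable setT (EFin \o (fun w => `|mn w| * tnorm2 w)).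
  apply: integrable_sqr; first exact: measurable_funM.
  by under eq_integral do rewrite exprMn real_normK ?num_real//.
have ispec z : Lam.-integrable setT (EFin \o spec p q z).
  by apply: integrable_mul_cos => //; exact: measurable_cst.
set D := d%:R * ln (16 * rho * C + 4).
have Q4 : 4 <= 16 * rho * C + 4 by have := mulr_ge0 rho0 C0; lra.
have D0 : 0 < D by rewrite mulr_gt0 ?ltr0n// ln_gt0//; lra.
(* The summand 4 in the logarithm and [d >= 1] give [expR D >= 4], whatever the diameter. *)
have expD : expR (- D) <= 2^-1.
  rewrite expRN lef_pV2 ?posrE ?expR_gt0// /D expRM_natl lnK ?posrE; last by lra.
  apply: le_trans (_ : (16 * rho * C + 4) ^+ 1 <= _); first by rewrite expr1; lra.
  by rewrite ler_weXn2l//; lra.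
have [net netP] := choice (fun s => level_net s hd rho0 C0).
have [E [mE PE HE]] := @chaining R d d0 Omega P m W Lam hW hm g Y N K C'^-1 rho t D net
  mg mY mtn Y0 (@tnorm2_ge0 R d) gY gN Ysq YN2 hBern (lt_le_trans ltr01 hK)
  (etrans (invr_gt0 C') C'0) ht D0 expD (fun s => (netP s).1) (fun s => (netP s).2) m.+1.
have devg z a : dev W Lam (spec p q z) a = sigma * dev W Lam (g z) a.
  rewrite /dev /g RintegralZr// -mulr_suml; field.
  by rewrite !gt_eqF.
have errE a x y : `|Dpq p q k x y - khat (fun j => W j a) p q x y|
    = `|dev W Lam (spec p q (x - y)) a|.
  by rewrite (Dpq_spec hk hder imn imnN) khatE distrC.
pose Z := [set z | exists x y, S x /\ S y /\ z = x - y].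
have ZE a : [set e | exists x y, S x /\ S y /\
      e = (`|Dpq p q k x y - khat (fun j => W j a) p q x y|)%:E]
    = [set `|dev W Lam (spec p q z) a|%:E | z in Z].
  apply/seteqP; split=> [_ [x [y [Sx [Sy ->]]]]|_ [_ [x [y [Sx [Sy ->]]]] <-]].
    by exists (x - y); [exists x, y|rewrite errE].
  by exists x, y; rewrite errE.
have Zrho z : Z z -> vnorm2 z <= rho.
  by move=> [x [y [Sx [Sy ->]]]]; exact: vnorm2_le_diam.
under eq_set do rewrite ZE.
set A := [set a | _].
have mA : measurable A.
  (* A random Lipschitz constant: the empirical plus the true mean of [|mn w| * N w], as given by
     [dev_abs_le]. *)
  pose lip a := m%:R^-1 * \sum_j (`|mn (W j a)| * N (W j a)) + \int[Lam]_w (`|mn w| * N w).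
  apply: (@measurable_sup_event R d d0 Omega Z (fun z => dev W Lam (spec p q z)) lip
    rho bound hd rho0 Zrho).
    by move=> z; apply: measurable_funB => //; exact: (measurable_avg hW).
  move=> a z z'; rewrite -devB//.
  have ih : Lam.-integrable setT (EFin \o (fun w => `|mn w| * N w * vnorm2 (z - z'))).
    have := integrableZR (vnorm2 (z - z')) imnN.
    by under eq_fun do rewrite mulrC.
  apply: le_trans (dev_abs_le W a (integrableBR (ispec z) (ispec z')) ih (spec_lip z z')) _.
  rewrite /dev /lip RintegralZr// -mulr_suml le_eqVlt; apply/orP; left; apply/eqP; ring.
have boundE : bound = sigma * (C3 * Num.sqrt D / Num.sqrt m%:R + C1 / Num.sqrt m%:R + C2 / m%:R
  + 24 * Num.sqrt 6 / Num.sqrt m%:R * (Num.sqrt t + Lm * t / 2)) by [].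
apply: le_trans PE; apply: le_measure; rewrite ?inE//.
(* The event includes equality with [bound], so a strict bound is needed off [E]. *)
move=> a; rewrite /A /= => ba; apply: contrapT => nE.
move: ba; apply/negP; rewrite -ltNge.
set B := 6 * _ + _ + _ + _ in HE.
apply: (@le_lt_trans _ _ (sigma * B)%:E).
  apply: ge_ereal_sup => _ [z Zz <-]; rewrite lee_fin devg normrM gtr0_norm// ler_pM2l//.
  exact: HE (Zrho z Zz).
rewrite boundE lte_fin ltr_pM2l//.
exact: (chaining_bound_lt hm (ltW D0) ht hK).
Qed.
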